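(* Let $L$ be a nilpotent Lie superalgebra over $\mathbb{F}$ of dimension $(m|n)$. Then $$\dim \mathcal{M}(L)= \frac{1}{2}\big((m+n)^2+(n-m)\big)-1$$ if and only if $L\cong\mathcal{H}(1,0)=H(1)$, the Heisenberg Lie algebra of dimension $3$.
   Context: Let $\mathbb{F}$ be an algebraically closed field of characteristic $\neq 2,3$; all superspaces and superalgebras are over $\mathbb{F}$. A Lie superalgebra is a $\mathbb{Z}_2$-graded vector space $L=L_0\oplus L_1$ with a bilinear bracket such that $[L_a,L_b]\subseteq L_{a+b}$, and for homogeneous $x,y,z$ (with $|x|$ denoting the degree of $x$): $[x,y]=-(-1)^{|x||y|}[y,x]$ and $(-1)^{|x||z|}[x,[y,z]]+(-1)^{|y||x|}[y,[z,x]]+(-1)^{|z||y|}[z,[x,y]]=0$. A Lie algebra is regarded as a Lie superalgebra with zero odd part. Homomorphisms are linear maps that preserve degree and bracket. For graded subspaces $A,B$, $[A,B]$ denotes the linear span of all brackets $[a,b]$, $a\in A$, $b\in B$. $L$ is nilpotent if $L^{c}=0$ for some $c$, where $L^1=L$ and $L^{i+1}=[L^i,L]$. Schur multiplier: let $0\to R\to F\to L\to 0$ be a free presentation of $L$ (i.e. $F$ is a free Lie superalgebra, and $R$ is the kernel of a surjective homomorphism $F\to L$ of Lie superalgebras). Then $\mathcal{M}(L)=\dfrac{R\cap[F,F]}{[R,F]}$. This is an abelian Lie superalgebra, independent (up to isomorphism) of the choice of free presentation. $\dim L=(m|n)$ means $\dim L_0=m$ and $\dim L_1=n$ (both finite);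 $\dim\mathcal{M}(L)$ in the formula denotes the total dimension (even plus odd). $\mathcal{H}(1,0)=H(1)$ is the Heisenberg Lie algebra with basis $x_1,x_2,z$, all even, whose only non-zero bracket of basis elements (up to antisymmetry) is $[x_1,x_2]=z$. *)

(* Defs.v *)
From HB Require Import structures.
From mathcomp Require Import all_boot all_order all_algebra.
From mathcomp Require Import ring.
From mathcomp Require Import boolp classical_sets.

Set Implicit Arguments.
Unset Strict Implicit.
Unset Printing Implicit Defensive.

Import GRing.Theory.
Local Open Scope classical_set_scope.
Local Open Scope ring_scope.

Section Subspaces.
Variables (K : fieldType) (V : lmodType K).

Definition subspace (A : set V) : Prop := GRing.submod_closed [in A].

Definition lspan (A : set V) : set V := smallest subspace A.

(* [dim_quot A B d] is dim (A / B) = d, for subspaces B `<=` A of V: the classes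
   of v_0, ..., v_(d-1) form a basis of A / B. *)
Definition dim_quot (A B : set V) (d : nat) : Prop :=
  exists v : 'I_d -> V,
    [/\ forall i, A (v i),
        forall x, A x -> exists c : 'I_d -> K, B (x - \sum_i c i *: v i)
      & forall c : 'I_d -> K, B (\sum_i c i *: v i) -> forall i, c i = 0].

Definition has_dim (A : set V) (d : nat) : Prop := dim_quot A [set 0] d.

End Subspaces.

(* Degrees are booleans: [false] is even, [true] is odd, and their sum is [(+)].
   [grade b] is the homogeneous component of degree b. *)
HB.mixin Record isLieSuper (K : fieldType) L of GRing.Lmodule K L := {
  grade : bool -> set L;
  brk : L -> L -> L;
  grade_subspace : forall b, subspace (grade b);
  grade_decomp : forall x,
    exists x0 x1, [/\ grade false x0, grade true x1 & x = x0 + x1];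
  grade_disjoint : forall x, grade false x -> grade true x -> x = 0;
  brk_linearl : forall z, linear (brk^~ z);
  brk_linearr : forall z, linear (brk z);
  brk_grade : forall a b x y,
    grade a x -> grade b y -> grade (a (+) b) (brk x y);
  brk_skew : forall a b x y, grade a x -> grade b y ->
    brk x y = - ((-1) ^+ (a && b) *: brk y x);
  brk_jacobi : forall a b c x y z, grade a x -> grade b y -> grade c z ->
    (-1) ^+ (a && c) *: brk x (brk y z)
    + (-1) ^+ (b && a) *: brk y (brk z x)
    + (-1) ^+ (c && b) *: brk z (brk x y) = 0 }.

#[short(type="lieSuperType")]
HB.structure Definition LieSuper (K : fieldType) :=
  { L of isLieSuper K L & GRing.Lmodule K L }.

Section LieSuperTheory.
Variable K : fieldType.

Definition brk_set (L : lieSuperType K) (A B : set L) : set L :=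
  lspan [set brk a b | a in A & b in B].

(* [lcs L i] is L^(i+1). *)
Definition lcs (L : lieSuperType K) (i : nat) : set L :=
  iter i (fun A : set L => brk_set A setT) setT.
Arguments lcs : clear implicits.

Definition nilpotent (L : lieSuperType K) : Prop :=
  exists i, lcs L i = [set 0].

Definition superdim (L : lieSuperType K) (m n : nat) : Prop :=
  has_dim (grade false : set L) m /\ has_dim (grade true : set L) n.

Definition lie_hom (L M : lieSuperType K) (f : {linear L -> M}) : Prop :=
  (forall b x, grade b x -> grade b (f x)) /\ {morph f : x y / brk x y}.

Definition lie_isom (L M : lieSuperType K) : Prop :=
  exists2 f : {linear L -> M}, lie_hom f & bijective f.

(* F is the free Lie superalgebra on the graded set (X, deg), embedded by i. *)
Definition is_free (X : Type) (deg : X -> bool)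
    (F : lieSuperType K) (i : X -> F) : Prop :=
  (forall x, grade (deg x) (i x)) /\
  forall (M : lieSuperType K) (g : X -> M), (forall x, grade (deg x) (g x)) ->
    exists f : {linear F -> M},
      [/\ lie_hom f, forall x, f (i x) = g x
        & forall f' : {linear F -> M},
            lie_hom f' -> (forall x, f' (i x) = g x) -> f' =1 f].

Record free_presentation (L : lieSuperType K) := FreePresentation {
  fp_gen : Type;
  fp_deg : fp_gen -> bool;
  fp_free : lieSuperType K;
  fp_inj : fp_gen -> fp_free;
  fp_freeP : is_free fp_deg fp_inj;
  fp_map : {linear fp_free -> L};
  fp_hom : lie_hom fp_map;
  fp_surj : forall y, exists x, fp_map x = y }.

Definition fp_ker (L : lieSuperType K) (P : free_presentation L) :
    set (fp_free P) :=
  [set x | fp_map P x = 0].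
Arguments fp_ker {L} P.

(* The multiplier M(L) computed from P is (R `&` [F, F]) / [R, F]; this is its
   total dimension. *)
Definition dim_multiplier (L : lieSuperType K) (P : free_presentation L)
    (d : nat) : Prop :=
  dim_quot (fp_ker P `&` brk_set setT setT) (brk_set (fp_ker P) setT) d.

End LieSuperTheory.
Arguments lcs {K} L i.
Arguments fp_ker {K L} P.

(* The Heisenberg Lie algebra H(1), in the coordinates of its basis x1, x2, z. *)
Definition heisenberg (K : fieldType) : Type := 'rV[K]_3.

Section Heisenberg.
Variable K : fieldType.
Local Notation H := (heisenberg K).

HB.instance Definition _ := GRing.Lmodule.on H.

Definition heis_x1 : H := delta_mx 0 0.
Definition heis_x2 : H := delta_mx 0 1.
Definition heis_z : H := delta_mx 0 2.

Definition heis_grade (b : bool) : set H := if b then [set 0] else setT.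

Definition heis_brk (u v : H) : H :=
  ((u : 'rV_3) 0 0 * (v : 'rV_3) 0 1 - (u : 'rV_3) 0 1 * (v : 'rV_3) 0 0)
    *: heis_z.

Lemma heis_grade_subspace b : subspace (heis_grade b).
Proof.
split; rewrite ?inE; first by case: b.
move=> a u v; rewrite !inE; case: b => //= -> ->.
by rewrite scaler0 addr0.
Qed.

Lemma heis_brk0 (u v : H) : (u = 0) \/ (v = 0) -> heis_brk u v = 0.
Proof.
by rewrite /heis_brk; case=> ->; rewrite !mxE !(mulr0, mul0r) subr0 scale0r.
Qed.

Fact heis_decomp (x : H) : exists x0 x1,
  [/\ heis_grade false x0, heis_grade true x1 & x = x0 + x1].
Proof. by exists x, 0; split=> //; rewrite addr0. Qed.

Fact heis_disjoint (x : H) :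
  heis_grade false x -> heis_grade true x -> x = 0.
Proof. by []. Qed.

Fact heis_linearl (w : H) : linear (heis_brk^~ w).
Proof.
move=> a u v; rewrite /heis_brk !mxE scalerA -scalerDl; congr (_ *: _); ring.
Qed.

Fact heis_linearr (w : H) : linear (heis_brk w).
Proof.
move=> a u v; rewrite /heis_brk !mxE scalerA -scalerDl; congr (_ *: _); ring.
Qed.

Fact heis_brk_grade a b (x y : H) : heis_grade a x -> heis_grade b y ->
  heis_grade (a (+) b) (heis_brk x y).
Proof. by case: a; case: b => //= hx hy; apply: heis_brk0; auto. Qed.

Fact heis_skew a b (x y : H) : heis_grade a x -> heis_grade b y ->
  heis_brk x y = - ((-1) ^+ (a && b) *: heis_brk y x).
Proof.
case: a => /= [->|_]; first by rewrite !heis_brk0 ?scaler0 ?oppr0; auto.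
move=> _; rewrite scale1r /heis_brk -scaleNr; congr (_ *: _); ring.
Qed.

Lemma heis_brkz (u v w : H) : heis_brk u (heis_brk v w) = 0.
Proof.
by rewrite {1}/heis_brk !mxE /= !(mulr0, mul0r) subr0 scale0r.
Qed.

Fact heis_jacobi a b c (x y z : H) :
  heis_grade a x -> heis_grade b y -> heis_grade c z ->
  (-1) ^+ (a && c) *: heis_brk x (heis_brk y z)
  + (-1) ^+ (b && a) *: heis_brk y (heis_brk z x)
  + (-1) ^+ (c && b) *: heis_brk z (heis_brk x y) = 0.
Proof. by move=> _ _ _; rewrite !heis_brkz !scaler0 !addr0. Qed.

HB.instance Definition _ := isLieSuper.Build K H
  heis_grade_subspace heis_decomp heis_disjoint heis_linearl heis_linearr
  heis_brk_grade heis_skew heis_jacobi.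

Fact heis_brk12 : brk heis_x1 heis_x2 = heis_z.
Proof. by rewrite /brk /= /heis_brk !mxE /= mulr1 mulr0 subr0 scale1r. Qed.

Fact heis_brk1z : brk heis_x1 heis_z = 0.
Proof. by rewrite /brk /= /heis_brk !mxE /= !mulr0 subr0 scale0r. Qed.

Fact heis_brk2z : brk heis_x2 heis_z = 0.
Proof. by rewrite /brk /= /heis_brk !mxE /= !mulr0 subr0 scale0r. Qed.

End Heisenberg.

(* Every Lie superalgebra has a free presentation: the free Lie superalgebra on
   a graded set is built as formal terms modulo the axioms, with a unary symbol
   [Tevn] for the projection onto the even part. *)
Module FreeLie.
Section FreeConstruction.
Variables (K : fieldType) (X : Type) (deg : X -> bool).

Inductive term : Type :=
| Tgen of X | Tzero | Topp of term | Tadd of term & term | Tscale of K & term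
| Tevn of term | Tbrk of term & term.

Definition Tpart (b : bool) (t : term) : term :=
  if b then Tadd t (Topp (Tevn t)) else Tevn t.

Definition Tsgn (b : bool) (t : term) : term := Tscale ((-1) ^+ b) t.

Inductive teqv : term -> term -> Prop :=
| Erefl t : teqv t t
| Esym s t : teqv s t -> teqv t s
| Etrans s t u : teqv s t -> teqv t u -> teqv s u
| Copp s t : teqv s t -> teqv (Topp s) (Topp t)
| Cadd s t s' t' : teqv s s' -> teqv t t' -> teqv (Tadd s t) (Tadd s' t')
| Cscale a s t : teqv s t -> teqv (Tscale a s) (Tscale a t)
| Cevn s t : teqv s t -> teqv (Tevn s) (Tevn t)
| Cbrk s t s' t' : teqv s s' -> teqv t t' -> teqv (Tbrk s t) (Tbrk s' t')
| EaddA s t u : teqv (Tadd s (Tadd t u)) (Tadd (Tadd s t) u)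
| EaddC s t : teqv (Tadd s t) (Tadd t s)
| Eadd0 t : teqv (Tadd Tzero t) t
| EaddN t : teqv (Tadd (Topp t) t) Tzero
| EscaleA a b t : teqv (Tscale a (Tscale b t)) (Tscale (a * b) t)
| Escale1 t : teqv (Tscale 1 t) t
| EscaleDr a s t : teqv (Tscale a (Tadd s t)) (Tadd (Tscale a s) (Tscale a t))
| EscaleDl t a b : teqv (Tscale (a + b) t) (Tadd (Tscale a t) (Tscale b t))
| Eevn_lin a s t : teqv (Tevn (Tadd (Tscale a s) t))
                        (Tadd (Tscale a (Tevn s)) (Tevn t))
| Eevn_evn t : teqv (Tevn (Tevn t)) (Tevn t)
| Eevn_gen x : teqv (Tevn (Tgen x)) (if deg x then Tzero else Tgen x)
| Ebrk_linl u a s t : teqv (Tbrk (Tadd (Tscale a s) t) u)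
                           (Tadd (Tscale a (Tbrk s u)) (Tbrk t u))
| Ebrk_linr u a s t : teqv (Tbrk u (Tadd (Tscale a s) t))
                           (Tadd (Tscale a (Tbrk u s)) (Tbrk u t))
| Ebrk_evn a b s t : teqv (Tevn (Tbrk (Tpart a s) (Tpart b t)))
    (if a (+) b then Tzero else Tbrk (Tpart a s) (Tpart b t))
| Ebrk_skew a b s t : teqv (Tbrk (Tpart a s) (Tpart b t))
    (Topp (Tsgn (a && b) (Tbrk (Tpart b t) (Tpart a s))))
| Ebrk_jacobi a b c s t u :
    teqv (Tadd (Tadd
      (Tsgn (a && c) (Tbrk (Tpart a s) (Tbrk (Tpart b t) (Tpart c u))))
      (Tsgn (b && a) (Tbrk (Tpart b t) (Tbrk (Tpart c u) (Tpart a s)))))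
      (Tsgn (c && b) (Tbrk (Tpart c u) (Tbrk (Tpart a s) (Tpart b t)))))
    Tzero.

HB.instance Definition _ := gen_eqMixin term.
HB.instance Definition _ := gen_choiceMixin term.

Definition teqvb : rel term := fun s t => `[< teqv s t >].

Fact teqvb_equiv : equiv_class_of teqvb.
Proof.
split.
- by move=> t; apply/asboolP; constructor.
- by move=> s t; apply/asboolP/asboolP; apply: Esym.
- move=> t s u /asboolP st /asboolP tu; apply/asboolP; exact: Etrans st tu.
Qed.

Canonical teqv_equiv := EquivRelPack teqvb_equiv.
Definition free_lie := {eq_quot teqv_equiv}%qT.
HB.instance Definition _ := EqQuotient.on free_lie.
HB.instance Definition _ := Choice.on free_lie.

Definition cls (t : term) : free_lie := (\pi t)%qT.
Definition rep (q : free_lie) : term := repr q.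

Fact clsK q : cls (rep q) = q. Proof. exact: reprK. Qed.

Fact clsP s t : cls s = cls t <-> teqv s t.
Proof.
split=> h; first by apply/asboolP; move/eqmodP: h.
by apply/eqmodP/asboolP.
Qed.

Fact rep_cls t : teqv (rep (cls t)) t. Proof. by apply/clsP; rewrite clsK. Qed.

Fact cls_ind (P : free_lie -> Prop) : (forall t, P (cls t)) -> forall q, P q.
Proof. by move=> h q; rewrite -(clsK q). Qed.

Definition fzero := cls Tzero.
Definition fopp p := locked (cls (Topp (rep p))).
Definition fadd p q := locked (cls (Tadd (rep p) (rep q))).
Definition fscale a p := locked (cls (Tscale a (rep p))).
Definition fevn p := locked (cls (Tevn (rep p))).
Definition fbrk p q := locked (cls (Tbrk (rep p) (rep q))).

Fact foppE t : fopp (cls t) = cls (Topp t).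
Proof. by rewrite /fopp -lock; apply/clsP; apply: Copp; apply: rep_cls. Qed.
Fact faddE s t : fadd (cls s) (cls t) = cls (Tadd s t).
Proof. by rewrite /fadd -lock; apply/clsP; apply: Cadd; apply: rep_cls. Qed.
Fact fscaleE a t : fscale a (cls t) = cls (Tscale a t).
Proof. by rewrite /fscale -lock; apply/clsP; apply: Cscale; apply: rep_cls. Qed.
Fact fevnE t : fevn (cls t) = cls (Tevn t).
Proof. by rewrite /fevn -lock; apply/clsP; apply: Cevn; apply: rep_cls. Qed.
Fact fbrkE s t : fbrk (cls s) (cls t) = cls (Tbrk s t).
Proof. by rewrite /fbrk -lock; apply/clsP; apply: Cbrk; apply: rep_cls. Qed.

Definition fE := (foppE, faddE, fscaleE, fevnE, fbrkE).

Fact faddA : associative fadd.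
Proof.
elim/cls_ind=> s; elim/cls_ind=> t; elim/cls_ind=> u.
by rewrite !fE; apply/clsP; constructor.
Qed.
Fact faddC : commutative fadd.
Proof.
by elim/cls_ind=> s; elim/cls_ind=> t; rewrite !fE; apply/clsP; constructor.
Qed.
Fact fadd0 : left_id fzero fadd.
Proof. by elim/cls_ind=> s; rewrite /fzero !fE; apply/clsP; constructor. Qed.
Fact faddN : left_inverse fzero fopp fadd.
Proof. by elim/cls_ind=> s; rewrite /fzero !fE; apply/clsP; constructor. Qed.

HB.instance Definition _ := GRing.isZmodule.Build free_lie faddA faddC fadd0 faddN.

Fact fscaleA a b q : fscale a (fscale b q) = fscale (a * b) q.
Proof. by elim/cls_ind: q => s; rewrite !fE; apply/clsP; constructor. Qed.
Fact fscale1 : left_id 1 fscale.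
Proof. by elim/cls_ind=> s; rewrite !fE; apply/clsP; constructor. Qed.
Fact fscaleDr : right_distributive fscale +%R.
Proof.
move=> a; elim/cls_ind=> s; elim/cls_ind=> t.
by rewrite /GRing.add /= !fE; apply/clsP; constructor.
Qed.
Fact fscaleDl q : {morph fscale^~ q : a b / a + b}.
Proof.
move=> a b; elim/cls_ind: q => s.
by rewrite /(fscale a _ + _) /GRing.add /= !fE; apply/clsP; constructor.
Qed.

HB.instance Definition _ :=
  GRing.Zmodule_isLmodule.Build K free_lie fscaleA fscale1 fscaleDr fscaleDl.

Fact cls0 : cls Tzero = 0. Proof. by []. Qed.
Fact clsN t : cls (Topp t) = - cls t. Proof. by rewrite -foppE. Qed.
Fact clsD s t : cls (Tadd s t) = cls s + cls t. Proof. by rewrite -faddE. Qed.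
Fact clsZ a t : cls (Tscale a t) = a *: cls t. Proof. by rewrite -fscaleE. Qed.
Fact cls_evn t : cls (Tevn t) = fevn (cls t). Proof. by rewrite fevnE. Qed.
Fact cls_brk s t : cls (Tbrk s t) = fbrk (cls s) (cls t).
Proof. by rewrite fbrkE. Qed.
Definition clsE := (cls0, clsN, clsD, clsZ, cls_evn, cls_brk).

Fact fevn_linear : linear fevn.
Proof.
move=> a; elim/cls_ind=> s; elim/cls_ind=> t; rewrite -!clsE; apply/clsP.
by constructor.
Qed.
HB.instance Definition _ := GRing.isLinear.Build K free_lie free_lie _ fevn fevn_linear.

Fact fevn_id q : fevn (fevn q) = fevn q.
Proof. by elim/cls_ind: q => t; rewrite -!clsE; apply/clsP; constructor. Qed.

Definition fgrade (b : bool) : set free_lie :=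
  [set q | fevn q = if b then 0 else q].

Definition fpart (b : bool) q := if b then q - fevn q else fevn q.

Fact cls_part b t : cls (Tpart b t) = fpart b (cls t).
Proof. by case: b; rewrite /= !clsE. Qed.

Fact cls_sgn b t : cls (Tsgn b t) = (-1) ^+ b *: cls t.
Proof. by rewrite clsE. Qed.

Fact fpartP b q : fgrade b q -> fpart b q = q.
Proof. by case: b; rewrite /fgrade /= => ->; rewrite ?subr0. Qed.

Fact fgrade_subspace b : subspace (fgrade b).
Proof.
split; first by rewrite inE /fgrade /= linear0; case: b.
move=> a p q; rewrite !inE /fgrade /= fevn_linear => -> ->.
by case: b; rewrite ?scaler0 ?addr0.
Qed.

Fact fgrade_decomp q : exists q0 q1,
  [/\ fgrade false q0, fgrade true q1 & q = q0 + q1].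
Proof.
exists (fevn q), (q - fevn q); split; rewrite /fgrade /= ?fevn_id //.
  by rewrite linearB /= fevn_id subrr.
by rewrite addrC subrK.
Qed.

Fact fgrade_disjoint q : fgrade false q -> fgrade true q -> q = 0.
Proof. by rewrite /fgrade /= => ->. Qed.

Fact fbrk_linearl r : linear (fbrk^~ r).
Proof.
move=> a; elim/cls_ind=> s; elim/cls_ind=> t; elim/cls_ind: r => u.
by rewrite -!clsE; apply/clsP; constructor.
Qed.

Fact fbrk_linearr r : linear (fbrk r).
Proof.
move=> a; elim/cls_ind=> s; elim/cls_ind=> t; elim/cls_ind: r => u.
by rewrite -!clsE; apply/clsP; constructor.
Qed.

Fact fbrk_grade a b p q : fgrade a p -> fgrade b q ->
  fgrade (a (+) b) (fbrk p q).
Proof.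
move=> /fpartP <- /fpartP <-; elim/cls_ind: p => s; elim/cls_ind: q => t.
rewrite -!cls_part -!clsE /fgrade /= -!clsE.
by have /clsP -> := Ebrk_evn a b s t; case: (_ (+) _).
Qed.

Fact fbrk_skew a b p q : fgrade a p -> fgrade b q ->
  fbrk p q = - ((-1) ^+ (a && b) *: fbrk q p).
Proof.
move=> /fpartP <- /fpartP <-; elim/cls_ind: p => s; elim/cls_ind: q => t.
rewrite -!cls_part -!clsE; apply/clsP; exact: Ebrk_skew.
Qed.

Fact fbrk_jacobi a b c p q r : fgrade a p -> fgrade b q -> fgrade c r ->
  (-1) ^+ (a && c) *: fbrk p (fbrk q r)
  + (-1) ^+ (b && a) *: fbrk q (fbrk r p)
  + (-1) ^+ (c && b) *: fbrk r (fbrk p q) = 0.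
Proof.
move=> /fpartP <- /fpartP <- /fpartP <-.
elim/cls_ind: p => s; elim/cls_ind: q => t; elim/cls_ind: r => u.
rewrite -!cls_part -!clsE; apply/clsP; exact: Ebrk_jacobi.
Qed.

HB.instance Definition _ := isLieSuper.Build K free_lie
  fgrade_subspace fgrade_decomp fgrade_disjoint fbrk_linearl fbrk_linearr
  fbrk_grade fbrk_skew fbrk_jacobi.

Definition fgen (x : X) : free_lie := cls (Tgen x).

Section Eval.
Variables (M : lieSuperType K) (g : X -> M).
Hypothesis gP : forall x, grade (deg x) (g x).

Definition evn (y : M) : M := sval (cid (grade_decomp y)).

Fact evnP y : grade false (evn y) /\ grade true (y - evn y).
Proof.
rewrite /evn; have [y1 [h0 h1 e]] := svalP (cid (grade_decomp y)); split=> //.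
by rewrite {1}e addrC addKr.
Qed.

Fact grade_lin b a (x y : M) : grade b x -> grade b y -> grade b (a *: x + y).
Proof.
move=> hx hy; have [_ h] := grade_subspace (s := M) b.
by have := h a x y; rewrite !inE; apply.
Qed.
Fact grade0 b : grade b (0 : M).
Proof. by have [h _] := grade_subspace (s := M) b; rewrite inE in h. Qed.

Fact evn_eq x0 (y : M) : grade false x0 -> grade true (y - x0) -> evn y = x0.
Proof.
move=> h0 h1; have [e0 e1] := evnP y; apply/eqP; rewrite -subr_eq0; apply/eqP.
apply: grade_disjoint.
  by rewrite addrC -scaleN1r; apply: grade_lin.
have -> : evn y - x0 = (-1) *: (y - evn y) + (y - x0).
  by rewrite scaleN1r opprB addrA subrK.
exact: grade_lin.
Qed.

Fact evn_linear : linear evn.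
Proof.
move=> a x y; have [x0 x1] := evnP x; have [y0 y1] := evnP y.
apply: evn_eq; first exact: grade_lin.
by rewrite opprD addrACA -scalerBr; apply: grade_lin.
Qed.

Fact evn_grade b (y : M) : grade b y -> evn y = if b then 0 else y.
Proof.
by case: b => h; apply: evn_eq; rewrite ?subr0 ?subrr //; apply: grade0.
Qed.

Fixpoint eval (t : term) : M :=
  match t with
  | Tgen x => g x
  | Tzero => 0
  | Topp t => - eval t
  | Tadd s t => eval s + eval t
  | Tscale a t => a *: eval t
  | Tevn t => evn (eval t)
  | Tbrk s t => brk (eval s) (eval t)
  end.

Fact eval_part b t : grade b (eval (Tpart b t)).
Proof. by have [] := evnP (eval t); case: b. Qed.

Fact eval_teqv s t : teqv s t -> eval s = eval t.
Proof.
elim=> //=; try by move=> *; congruence.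
- by move=> *; rewrite addrA.
- by move=> *; rewrite addrC.
- by move=> *; rewrite add0r.
- by move=> *; rewrite addNr.
- by move=> *; rewrite scalerA.
- by move=> *; rewrite scale1r.
- by move=> *; rewrite scalerDr.
- by move=> *; rewrite scalerDl.
- by move=> *; rewrite evn_linear.
- by move=> u; have [h _] := evnP (eval u); exact: evn_grade h.
- by move=> x; rewrite (evn_grade (gP x)); case: (deg x).
- by move=> *; rewrite brk_linearl.
- by move=> *; rewrite brk_linearr.
- move=> a b u v.
  rewrite (evn_grade (brk_grade _ _ _ _ (eval_part a u) (eval_part b v))).
  by case: (a (+) b).
- by move=> a b u v; apply: brk_skew; apply: eval_part.
- by move=> a b c u v w; apply: brk_jacobi; apply: eval_part.
Qed.

Definition feval (q : free_lie) : M := eval (rep q).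

Fact fevalE t : feval (cls t) = eval t.
Proof. exact/eval_teqv/rep_cls. Qed.

Fact feval_linear : linear feval.
Proof.
move=> a; elim/cls_ind=> s; elim/cls_ind=> t.
by rewrite -!clsE !fevalE.
Qed.
Definition feval_lin : {linear free_lie -> M} :=
  HB.pack feval (GRing.isLinear.Build K free_lie M _ feval feval_linear).

Fact feval_hom : lie_hom feval_lin.
Proof.
split=> [b q|].
  move/fpartP <-; elim/cls_ind: q => t.
  by rewrite -cls_part /= fevalE; apply: eval_part.
elim/cls_ind=> s; elim/cls_ind=> t.
have -> : brk (cls s) (cls t) = cls (Tbrk s t) by rewrite -fbrkE.
by rewrite /= !fevalE.
Qed.

Fact feval_uniq (f : {linear free_lie -> M}) :
  lie_hom f -> (forall x, f (fgen x) = g x) -> f =1 feval_lin.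
Proof.
move=> [fg fb] fx; elim/cls_ind=> t; rewrite /= fevalE; elim: t => /=.
- exact: fx.
- by rewrite cls0 linear0.
- by move=> t <-; rewrite clsN linearN.
- by move=> s <- t <-; rewrite clsD linearD.
- by move=> a t <-; rewrite clsZ linearZ.
- move=> t <-; apply/esym/evn_eq.
    by apply: fg; rewrite /grade /= /fgrade /= cls_evn fevn_id.
  rewrite -linearB; apply: fg; rewrite /grade /= /fgrade /= cls_evn.
  by rewrite linearB /= fevn_id subrr.
- move=> s <- t <-; rewrite -fb; congr (f _).
  by rewrite cls_brk.
Qed.

End Eval.

Lemma free_lie_free : is_free deg fgen.
Proof.
split=> [x|M g gP].
  rewrite /grade /= /fgrade /= -cls_evn.
  by have /clsP -> := Eevn_gen x; case: (deg x).
exists (feval_lin gP); split; first exact: feval_hom.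
  by move=> x; rewrite /= fevalE.
by move=> f'; apply: feval_uniq.
Qed.

End FreeConstruction.

Lemma presentation (K : fieldType) (L : lieSuperType K) :
  inhabited (free_presentation L).
Proof.
pose X := {b : bool & {x : L | grade b x}}.
pose deg (x : X) := tag x; pose g (x : X) : L := sval (tagged x).
have gP x : grade (deg x) (g x) by exact: (svalP (tagged x)).
have [_ /(_ L g gP) [f [fh fg _]]] := free_lie_free K deg.
constructor; apply: (FreePresentation (free_lie_free K deg) fh) => y.
have [y0 [y1 [h0 h1 ->]]] := grade_decomp y.
exists (fgen K deg (Tagged _ (exist _ y0 h0) : X)
        + fgen K deg (Tagged _ (exist _ y1 h1) : X)).
by rewrite linearD !fg.
Qed.

End FreeLie.

Lemma free_presentation_exists (K : fieldType) (L : lieSuperType K) :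
  inhabited (free_presentation L).
Proof. exact: FreeLie.presentation. Qed.

(* Main.v *)
Require Import Defs.
From mathcomp Require Import all_boot all_order all_algebra.
From HB Require Import structures.
From mathcomp Require Import ring lra zify boolp classical_sets.
Import GRing.Theory.
Local Open Scope ring_scope.

Set Implicit Arguments.
Unset Strict Implicit.
Unset Printing Implicit Defensive.

(** Let F -> L be a free presentation with kernel R, let (e_i) be a homogeneous
    basis of L and let D be the dimension of the super exterior square of L, so
    that the formula says dim M(L) = D - 1.

    Modulo [R, F] a bracket in F only depends on the images of its entries in L
    (brk_mod_ker). Hence [F, F] / [R, F] is spanned by D brackets of lifts of
    basis vectors, and the coordinates of a bracket are those of a super
    exterior product (wedge_span).

    Suppose dim M(L) = D - 1. If L is abelian, every coordinate of the super
    exterior product is a 2-cocycle; the corresponding central extensions of L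
    receive maps from F, which give D independent functionals on
    [F, F] / [R, F] = M(L), a contradiction (abelian_multiplier_ge). If L is not
    abelian, M(L) is the kernel of the map [F, F] / [R, F] -> [L, L] <> 0, and
    counting dimensions shows that the D brackets are independent and that
    [L, L] is a line spanned by a homogeneous z (multiplier_corank1), which is
    central because L is nilpotent. The Jacobi identity of F then becomes an
    identity in the super exterior square of L (wedge_jacobi):
      x /\ [y, w] + y /\ [w, x] + w /\ [x, y] = 0, up to signs,
    where each bracket is a multiple of z. On (x, x, x) with x odd it gives
    [x, x] = 0, as 3 is invertible; on (x, y, y) with x even and y odd it gives
    [x, y] = 0, as 2 is invertible. So z = [x, y] with x, y even, and the
    identity on (x, y, w) puts every w in the span of x, y, z: L is the
    Heisenberg algebra (heisenberg_char).

    Conversely, let X1, X2 lift x1, x2 and put Z = [X1, X2]. The space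
    [F, F] / [R, F] is spanned by Z, [X1, Z] and [X2, Z], and the last two span
    the multiplier. They are independent because they are separated by the
    functionals attached to the cocycles dual to x1 /\ z and x2 /\ z
    (heis_multiplier). *)

(** * Subspaces and spans *)

Section SubspaceTheory.
Variables (K : fieldType) (V : lmodType K).
Implicit Types A B : set V.

Lemma subspaceP A : subspace A <->
  A 0 /\ forall a x y, A x -> A y -> A (a *: x + y).
Proof.
split=> [[A0 AL]|[A0 AL]].
  split; first by rewrite inE in A0.
  by move=> a x y Ax Ay; have := AL a x y; rewrite !inE; apply.
by split=> [|a x y]; rewrite !inE //; apply: AL.
Qed.

Lemma subspace0 A : subspace A -> A 0.
Proof. by case/subspaceP. Qed.

Lemma subspaceZ A a x : subspace A -> A x -> A (a *: x).
Proof.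
by move=> /subspaceP[A0 AL] Ax; rewrite -[_ *: _]addr0; apply: AL.
Qed.

Lemma subspaceD A x y : subspace A -> A x -> A y -> A (x + y).
Proof.
by move=> /subspaceP[A0 AL] Ax Ay; rewrite -[x]scale1r; apply: AL.
Qed.

Lemma subspaceN A x : subspace A -> A x -> A (- x).
Proof. by move=> sA Ax; rewrite -scaleN1r; apply: subspaceZ. Qed.

Lemma subspaceB A x y : subspace A -> A x -> A y -> A (x - y).
Proof. by move=> sA Ax Ay; apply: subspaceD => //; apply: subspaceN. Qed.

Lemma subspace_sum A (I : Type) (r : seq I) (P : pred I) (F : I -> V) :
  subspace A -> (forall i, P i -> A (F i)) -> A (\sum_(i <- r | P i) F i).
Proof.
move=> sA AF; elim/big_ind: _ => //; first exact: subspace0.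
by move=> x y; apply: subspaceD.
Qed.

Lemma subspace_lspan A : subspace (lspan A).
Proof.
apply/subspaceP; split=> [B [/subspace0 //]|a x y Ax Ay B [sB AB]].
by apply: subspaceD => //; [apply: subspaceZ => //; apply: Ax|apply: Ay].
Qed.

Lemma lspan_gen A x : A x -> lspan A x.
Proof. by move=> Ax B [_]; apply. Qed.

Lemma lspan_min A B : subspace B -> (A `<=` B -> lspan A `<=` B)%classic.
Proof. by move=> sB AB x; apply. Qed.

End SubspaceTheory.

Lemma subspace_preim (K : fieldType) (V W : lmodType K) (f : {linear V -> W})
  (A : set W) : subspace A -> subspace (f @^-1` A)%classic.
Proof.
move=> sA; apply/subspaceP; split=> [|a x y] /=.
  by rewrite linear0; apply: subspace0.
rewrite linearP => Ax Ay; apply: subspaceD => //; exact: subspaceZ.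
Qed.

Lemma subspace_zero (K : fieldType) (V : lmodType K) :
  subspace [set 0 : V]%classic.
Proof.
by apply/subspaceP; split=> // a x y /= -> ->; rewrite scaler0 addr0.
Qed.

Lemma scaler_nat_eq0 (K : fieldType) (V : lmodType K) (k : nat) (v : V) :
  prime k -> k \notin [pchar K] -> k%:R *: v = 0 -> v = 0.
Proof.
move=> pk ck /eqP; rewrite scaler_eq0 => /orP[|/eqP//].
by move: ck; rewrite inE pk /= => /negPf->.
Qed.

(** * Lie superalgebras *)

Section LieTheory.
Variables (K : fieldType) (L : lieSuperType K).
Implicit Types (x y z : L) (a b c : bool).

HB.instance Definition _ z :=
  GRing.isLinear.Build K L L _ (brk z) (brk_linearr z).

Lemma brkZDl (k : K) x y z : brk (k *: x + y) z = k *: brk x z + brk y z.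
Proof. exact: brk_linearl. Qed.

Lemma brkDl x y z : brk (x + y) z = brk x z + brk y z.
Proof. by rewrite -[x]scale1r brkZDl !scale1r. Qed.

Lemma brk0l z : brk 0 z = 0.
Proof. by apply: (addIr (brk 0 z)); rewrite -brkDl !add0r. Qed.

Lemma brkZl (k : K) x z : brk (k *: x) z = k *: brk x z.
Proof. by rewrite -[k *: x]addr0 brkZDl brk0l addr0. Qed.

Lemma brkNl x z : brk (- x) z = - brk x z.
Proof. by rewrite -scaleN1r brkZl scaleN1r. Qed.

Lemma brkBl x y z : brk (x - y) z = brk x z - brk y z.
Proof. by rewrite brkDl brkNl. Qed.

Lemma brk_suml (I : Type) (r : seq I) (P : pred I) (F : I -> L) z :
  brk (\sum_(i <- r | P i) F i) z = \sum_(i <- r | P i) brk (F i) z.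
Proof. by elim/big_rec2: _ => [|i x y _ <-]; rewrite ?brk0l ?brkDl. Qed.

Lemma grade0 b : grade b (0 : L).
Proof. exact: subspace0 (grade_subspace b). Qed.

(** A homogeneous sum of an even and an odd vector is one of the two. *)
Lemma grade_add_homog b x y : grade false x -> grade true y ->
  grade b (x + y) -> (if b then x else y) = 0.
Proof.
case: b => gx gy gxy; apply: grade_disjoint => //.
  by rewrite -(addrK y x); apply: subspaceB => //; apply: grade_subspace.
rewrite -(addKr x y) addrC.
by apply: subspaceB => //; apply: grade_subspace.
Qed.

Lemma brk_even_skew x y : grade false x -> grade false y ->
  brk x y = - brk y x.
Proof. by move=> gx gy; rewrite (brk_skew _ _ _ _ gx gy) expr0 scale1r. Qed.

Hypothesis char2 : 2%N \notin [pchar K].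

Lemma brk_even_alt x : grade false x -> brk x x = 0.
Proof.
move=> gx; have /eqP := brk_even_skew gx gx; rewrite -addr_eq0 -mulr2n.
by rewrite -scaler_nat => /eqP; apply: scaler_nat_eq0.
Qed.

End LieTheory.

Lemma subspace_brk_set (K : fieldType) (L : lieSuperType K) (A B : set L) :
  subspace (brk_set A B).
Proof. exact: subspace_lspan. Qed.

Lemma brk_set_brk (K : fieldType) (L : lieSuperType K) (A B : set L) x y :
  A x -> B y -> brk_set A B (brk x y).
Proof. by move=> Ax By; apply: lspan_gen; exists x => //; exists y. Qed.

Lemma brk_set_min (K : fieldType) (L : lieSuperType K) (A B C : set L) :
  subspace C -> (forall x y, A x -> B y -> C (brk x y)) ->
  (brk_set A B `<=` C)%classic.
Proof. by move=> sC h; apply: lspan_min => // _ [x Ax [y By <-]]; apply: h. Qed.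

Lemma lie_isom_sym (K : fieldType) (L M : lieSuperType K) :
  lie_isom L M -> lie_isom M L.
Proof.
move=> [f [fg fb] [g fK gK]].
have glin : linear g by move=> a x y; apply: (can_inj fK); rewrite linearP !gK.
have glin0 : g 0 = 0 by rewrite -(linear0 f) fK.
pose gl : {linear M -> L} := HB.pack g (GRing.isLinear.Build K M L _ g glin).
exists gl; last by exists f.
split=> [b x gx|x y]; last by apply: (can_inj fK); rewrite fb /= !gK.
have [x0 [x1 [h0 h1 e]]] := grade_decomp (g x).
have /= := @grade_add_homog _ _ b (f x0) (f x1) (fg _ _ h0) (fg _ _ h1).
rewrite -linearD -e gK e => /(_ gx).
have f0 u : f u = 0 -> u = 0 by move=> fu; rewrite -(fK u) fu glin0.
by case: b gx => _ /f0 ->; rewrite ?add0r ?addr0.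
Qed.

(** * Presentations *)

Section Presentation.
Variables (K : fieldType) (L : lieSuperType K) (P : free_presentation L).
Local Notation F := (fp_free P).
Local Notation p := (fp_map P).
Local Notation RF := (brk_set (fp_ker P) setT).

Lemma fp_brk (x y : F) : p (brk x y) = brk (p x) (p y).
Proof. by case: (fp_hom P) => _ ->. Qed.

Lemma subspace_fp_ker : subspace (fp_ker P).
Proof. exact: (subspace_preim p (@subspace_zero _ _)). Qed.

(** Homogeneous vectors of L have homogeneous lifts of the same degree. *)
Lemma fp_lift b (y : L) : grade b y -> exists2 x : F, grade b x & p x = y.
Proof.
move=> gy; have [x px] := fp_surj P y.
have [pg _] := fp_hom P.
have [x0 [x1 [h0 h1 e]]] := grade_decomp x.
have ey : y = p x0 + p x1 by rewrite -px e linearD.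
have := @grade_add_homog _ _ b (p x0) (p x1) (pg _ _ h0) (pg _ _ h1).
rewrite -ey => /(_ gy).
case: b gy => _ e0; [exists x1 => //|exists x0 => //].
  by rewrite ey e0 add0r.
by rewrite ey e0 addr0.
Qed.

(** R is a graded subspace of F. *)
Lemma fp_ker_grade (r : F) : fp_ker P r -> exists r0 r1,
  [/\ grade false r0, grade true r1, r = r0 + r1, fp_ker P r0 & fp_ker P r1].
Proof.
move=> kr; have [pg _] := fp_hom P.
have [r0 [r1 [h0 h1 e]]] := grade_decomp r.
have k0 : p r0 = 0.
  apply: (@grade_add_homog _ _ true (p r0) (p r1)); try exact: pg.
  by rewrite -linearD -e kr; apply: grade0.
exists r0, r1; split=> //; rewrite /fp_ker /=.
by have := kr; rewrite /fp_ker /= e linearD k0 add0r.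
Qed.

Lemma brk_ker_l (r s : F) : p r = 0 -> RF (brk r s).
Proof. by move=> kr; exact: brk_set_brk kr I. Qed.

(** [R, F] is also spanned by the brackets with their R-entry on the right:
    R is graded, so super skew-symmetry applies. *)
Lemma brk_ker_r (r s : F) : p r = 0 -> RF (brk s r).
Proof.
move=> /fp_ker_grade[r0 [r1 [h0 h1 -> k0 k1]]].
have sRF := subspace_brk_set (fp_ker P) setT.
have [s0 [s1 [g0 g1 ->]]] := grade_decomp s.
rewrite linearD /= !brkDl.
have h a b u v : grade a u -> grade b v -> fp_ker P u -> RF (brk v u).
  move=> gu gv ku; rewrite (brk_skew _ _ _ _ gv gu).
  by apply: (subspaceN sRF); apply: (subspaceZ _ sRF); exact: brk_set_brk ku I.
by do 2!apply: (subspaceD sRF); eapply h; eauto.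
Qed.

(** Modulo [R, F], a bracket in F only depends on the images of its entries
    in L. *)
Lemma brk_mod_ker (s t s' t' : F) :
  p s = p s' -> p t = p t' -> RF (brk s t - brk s' t').
Proof.
move=> es et; rewrite -[brk s t](subrK (brk s' t)) -addrA -brkBl -linearB /=.
apply: (subspaceD (subspace_brk_set _ _)).
  by apply: brk_ker_l; rewrite linearB /= es subrr.
by apply: brk_ker_r; rewrite linearB /= et subrr.
Qed.

Lemma brk_set_ker_sub : (RF `<=` fp_ker P)%classic.
Proof.
apply: brk_set_min; first exact: subspace_fp_ker.
by move=> r s kr _; rewrite /fp_ker /= fp_brk kr brk0l.
Qed.

End Presentation.

(** * Central extensions by scalar cocycles *)

(** Scalar 2-cocycles on L, homogeneous of degree b: super skew-symmetric
    bilinear forms that vanish on a pair of degrees a, c unless a + c = b, and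
    satisfy the super Jacobi condition. *)
Record cocycle (K : fieldType) (L : lieSuperType K) (b : bool) := Cocycle {
  cocy : L -> L -> K;
  cocy_linl : forall z a x y, cocy (a *: x + y) z = a * cocy x z + cocy y z;
  cocy_linr : forall z a x y, cocy z (a *: x + y) = a * cocy z x + cocy z y;
  cocy_grade : forall a c x y,
    grade a x -> grade c y -> a (+) c != b -> cocy x y = 0;
  cocy_skew : forall a c x y, grade a x -> grade c y ->
    cocy x y = - ((-1) ^+ (a && c) * cocy y x);
  cocy_jacobi : forall a c d x y z, grade a x -> grade c y -> grade d z ->
    (-1) ^+ (a && d) * cocy x (brk y z)
    + (-1) ^+ (c && a) * cocy y (brk z x)
    + (-1) ^+ (d && c) * cocy z (brk x y) = 0 }.

(** The central extension of L by a line of degree b attached to w, carried by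
    L * K with bracket [(x, k), (y, l)] = ([x, y], w x y). *)
Definition cext (K : fieldType) (L : lieSuperType K) (b : bool)
  (w : cocycle L b) : Type := (L * K^o)%type.

Section CentralExtension.
Variables (K : fieldType) (L : lieSuperType K) (b : bool) (w : cocycle L b).
Local Notation E := (cext w).

HB.instance Definition _ := GRing.Lmodule.on E.

Definition cext_grade (c : bool) : set E :=
  [set u | grade c u.1 /\ (c != b -> u.2 = 0)]%classic.

Definition cext_brk (u v : E) : E := (brk u.1 v.1, cocy w u.1 v.1).

Fact cext_grade_subspace c : subspace (cext_grade c).
Proof.
apply/subspaceP; split=> [|a x y [x1 x2] [y1 y2]].
  by split=> //=; exact: grade0.
split=> /=; last by move=> cb; rewrite x2 // y2 // scaler0 addr0.
have sg := grade_subspace (s := L) c.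
by apply: (subspaceD sg) => //; exact: subspaceZ.
Qed.

Fact cext_decomp (u : E) : exists u0 u1,
  [/\ cext_grade false u0, cext_grade true u1 & u = u0 + u1].
Proof.
case: u => x k; have [x0 [x1 [h0 h1 ->]]] := grade_decomp x.
exists (x0, if b then 0 else k), (x1, if b then k else 0); split.
- by split=> //=; case: b.
- by split=> //=; case: b.
- by congr (_, _); case: b; rewrite /= ?add0r ?addr0.
Qed.

Fact cext_disjoint (u : E) : cext_grade false u -> cext_grade true u -> u = 0.
Proof.
case: u => x k [/= h0 k0] [/= h1 k1].
rewrite (grade_disjoint _ h0 h1).
by have -> : k = 0 by move: k0 k1; case: b => k0 k1; [exact: k0|exact: k1].
Qed.

Fact cext_linearl (z : E) : linear (cext_brk^~ z).
Proof.
move=> a x y; congr (_, _); first exact: (brkZDl a x.1 y.1 z.1).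
exact: (cocy_linl w z.1 a x.1 y.1).
Qed.

Fact cext_linearr (z : E) : linear (cext_brk z).
Proof.
move=> a x y; congr (_, _); first exact: (linearP (brk z.1)).
exact: (cocy_linr w z.1 a x.1 y.1).
Qed.

Fact cext_brk_grade a c (x y : E) : cext_grade a x -> cext_grade c y ->
  cext_grade (a (+) c) (cext_brk x y).
Proof.
move=> [hx _] [hy _]; split=> /=; first exact: brk_grade.
exact: (@cocy_grade _ _ _ w a c x.1 y.1).
Qed.

Fact cext_skew a c (x y : E) : cext_grade a x -> cext_grade c y ->
  cext_brk x y = - ((-1) ^+ (a && c) *: cext_brk y x).
Proof.
move=> [hx _] [hy _]; congr (_, _); first exact: brk_skew.
exact: (@cocy_skew _ _ _ w a c x.1 y.1).
Qed.

Fact cext_jacobi a c d (x y z : E) :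
  cext_grade a x -> cext_grade c y -> cext_grade d z ->
  (-1) ^+ (a && d) *: cext_brk x (cext_brk y z)
  + (-1) ^+ (c && a) *: cext_brk y (cext_brk z x)
  + (-1) ^+ (d && c) *: cext_brk z (cext_brk x y) = 0.
Proof.
move=> [hx _] [hy _] [hz _].
congr (_, _); first exact: brk_jacobi.
exact: (@cocy_jacobi _ _ _ w a c d x.1 y.1 z.1).
Qed.

HB.instance Definition _ := isLieSuper.Build K E
  cext_grade_subspace cext_decomp cext_disjoint cext_linearl cext_linearr
  cext_brk_grade cext_skew cext_jacobi.

End CentralExtension.

(** A free presentation F -> L lifts to the central extension attached to a
    cocycle w; its second component is a functional on F which computes w on
    brackets. *)
Lemma cocycle_functional (K : fieldType) (L : lieSuperType K)
  (P : free_presentation L) b (w : cocycle L b) :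
  exists phi : {linear fp_free P -> K^o},
    forall x y, phi (brk x y) = cocy w (fp_map P x) (fp_map P y).
Proof.
have [ig ex] := fp_freeP P; have [pg pb] := fp_hom P.
have [|f [[fg fb] fi _]] := ex (cext w) (fun x => (fp_map P (fp_inj x), 0)).
  by move=> x; split=> //=; apply: pg; apply: ig.
have [g [_ _ gu]] := ex L (fun x => fp_map P (fp_inj x)) (fun x => pg _ _ (ig x)).
have f1l : linear (fun x => (f x).1 : L) by move=> a x y; rewrite linearP.
have f2l : linear (fun x => (f x).2 : K^o) by move=> a x y; rewrite linearP.
pose f1 : {linear fp_free P -> L} :=
  HB.pack (fun x => (f x).1 : L) (GRing.isLinear.Build K _ L _ _ f1l).
pose f2 : {linear fp_free P -> K^o} :=
  HB.pack (fun x => (f x).2 : K^o) (GRing.isLinear.Build K _ K^o _ _ f2l).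
(* The first component lifts the presentation map, and agrees with it on
   generators. *)
have f1E x : (f x).1 = fp_map P x.
  rewrite (gu (fp_map P) (fp_hom P) (fun=> erefl)).
  apply: (gu f1) => [|y]; last by rewrite /= fi.
  split=> [c y gy|y z] /=; first by case: (fg _ _ gy).
  by rewrite fb.
exists f2 => x y /=; by rewrite fb /= !f1E.
Qed.

(** Such a functional factors through F / [R, F]. *)
Lemma functional_ker (K : fieldType) (L : lieSuperType K)
  (P : free_presentation L) b (w : cocycle L b)
  (phi : {linear fp_free P -> K^o}) :
  (forall x y, phi (brk x y) = cocy w (fp_map P x) (fp_map P y)) ->
  forall u, brk_set (fp_ker P) setT u -> phi u = 0.
Proof.
move=> phiE u; apply: (@brk_set_min _ _ _ _ (phi @^-1` [set 0])%classic).
  exact: (subspace_preim phi (@subspace_zero _ _)).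
move=> r s kr _; rewrite /= phiE kr.
by have := cocy_linl w (fp_map P s) (-1) 0 0; rewrite scaler0 addr0 mulN1r addNr.
Qed.

(** * Coordinates on the exterior square *)

(** The basis of the super exterior square of a graded space with basis
    (e_i), e_i of degree [deg i]: pairs i < j, and pairs (i, i) with e_i odd. *)
Definition wpairs N (deg : 'I_N -> bool) : pred ('I_N * 'I_N) :=
  [pred t : 'I_N * 'I_N | (t.1 < t.2)%N || (t.1 == t.2) && deg t.1].

(** The coordinates of the super exterior product of two vectors, on the basis
    indexed by [wpairs deg]. *)
Definition wedge (K : fieldType) N (deg : 'I_N -> bool) (a b : 'rV[K]_N)
    (t : 'I_N * 'I_N) : K :=
  if t.1 == t.2 then a 0 t.1 * b 0 t.1
  else a 0 t.1 * b 0 t.2 - (-1) ^+ (deg t.1 && deg t.2) * (a 0 t.2 * b 0 t.1).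

(** The dimension of the super exterior square, in dimension (m|n). *)
Lemma card_wpairs m n :
  (2 * #|wpairs (fun i : 'I_(m + n) => m <= i)| + m = (m + n) ^ 2 + n)%N.
Proof.
set N := (m + n)%N.
pose lt : pred ('I_N * 'I_N) := [pred t : 'I_N * 'I_N | t.1 < t.2]%N.
pose gt : pred ('I_N * 'I_N) := [pred t : 'I_N * 'I_N | t.2 < t.1]%N.
have cs : #|gt| = #|lt|.
  pose sw (t : 'I_N * 'I_N) := (t.2, t.1).
  have swK : involutive sw by case.
  rewrite -(card_image (inv_inj swK) lt); apply: eq_card => t.
  apply/idP/fintype.imageP => [h|[u hu ->]] //.
  by exists (sw t) => //; rewrite swK.
pose di (i : 'I_N) := (i, i).
have dinj : injective di by move=> i j [].
have cd (A : pred 'I_N) : #|[pred t : 'I_N * 'I_N | (t.1 == t.2) && A t.1]| = #|A|.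
  rewrite -(card_image dinj A); apply: eq_card => -[i j].
  apply/idP/fintype.imageP => [/andP[/= /eqP -> Aj]|[k Ak [-> ->]]].
    by exists j.
  by rewrite unfold_in /= eqxx.
have c1 : #|wpairs (fun i : 'I_N => (m <= i)%N)| = (#|lt| + n)%N.
  have -> : n = #|[pred i : 'I_N | (m <= i)%N]|.
    rewrite -[LHS]card_ord -[LHS](card_image (@rshift_inj m n)).
    apply: eq_card => i; rewrite !inE; apply/fintype.imageP/idP => [[j _ ->]|mi].
      by rewrite leq_addr.
    have lj : (i - m < n)%N by have := ltn_ord i; rewrite /N in i mi *; lia.
    by exists (Ordinal lj) => //; apply: val_inj => /=; rewrite subnKC.
  rewrite -cd -cardUI.
  rewrite (eq_card0 (A := predI _ _)) ?addn0; last first.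
    by case=> i j; rewrite !inE /= andbCA; case: eqP => // ->; rewrite ltnn.
  by apply: eq_card => t; rewrite !inE.
have c2 : (#|lt| + #|gt| + N = N ^ 2)%N.
  rewrite -[X in (_ + X)%N](card_ord N) -(cd predT).
  have -> : (N ^ 2 = #|{: 'I_N * 'I_N}|)%N by rewrite card_prod card_ord.
  rewrite -(cardC lt) -addnA; congr (_ + _)%N.
  rewrite -cardUI (eq_card0 (A := predI _ _)) ?addn0; last first.
    by case=> i j; rewrite !inE /= andbCA; case: eqP => // ->; rewrite ltnn.
  by apply: eq_card => -[i j]; rewrite !inE /= andbT -val_eqE /=; lia.
by rewrite c1; move: c2; rewrite cs; lia.
Qed.

Section Wedge.
Variables (K : fieldType) (N : nat) (deg : 'I_N -> bool).
Implicit Types a b c : 'rV[K]_N.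

Lemma wedge_linl (k : K) a b c t :
  wedge deg (k *: a + b) c t = k * wedge deg a c t + wedge deg b c t.
Proof. by rewrite /wedge !mxE; case: ifP => _; ring. Qed.

Lemma wedge_linr (k : K) a b c t :
  wedge deg c (k *: a + b) t = k * wedge deg c a t + wedge deg c b t.
Proof. by rewrite /wedge !mxE; case: ifP => _; ring. Qed.

Lemma wedge_delta (s t : 'I_N * 'I_N) : wpairs deg s -> wpairs deg t ->
  wedge deg (delta_mx 0 t.1 : 'rV[K]_N) (delta_mx 0 t.2) s = (s == t)%:R.
Proof.
case: s t => [i j] [k l]; rewrite /wpairs /wedge /= !mxE /= => hs ht.
rewrite xpair_eqE; case: eqP => [<-|/eqP nij].
  by rewrite -natrM mulnb.
rewrite -!natrM !mulnb; case: (boolP ((j == k) && (i == l))) => [|_].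
  case/andP => /eqP ejk /eqP eil; subst k l.
  case/orP: ht => [ji|/andP[/eqP eji _]]; last by rewrite eji eqxx in nij.
  case/orP: hs => [ij|/andP[/eqP eij _]]; last by rewrite eij eqxx in nij.
  by move: (ltn_trans ij ji); rewrite ltnn.
by rewrite mulr0 subr0.
Qed.

End Wedge.

(** The bracket of two combinations of homogeneous vectors e_i factors through
    the super exterior square; characteristic 2 is excluded so that [e_i, e_i] = 0 for e_i even. *)
Lemma brk_wedge (K : fieldType) (char2 : 2%N \notin [pchar K])
  (M : lieSuperType K) N (deg : 'I_N -> bool) (e : 'I_N -> M)
  (eP : forall i, grade (deg i) (e i)) (a b : 'rV[K]_N) :
  brk (\sum_i a 0 i *: e i) (\sum_i b 0 i *: e i)
  = \sum_(t in wpairs deg) wedge deg a b t *: brk (e t.1) (e t.2).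
Proof.
pose G (t : 'I_N * 'I_N) := (a 0 t.1 * b 0 t.2) *: brk (e t.1) (e t.2).
have -> : brk (\sum_i a 0 i *: e i) (\sum_i b 0 i *: e i) = \sum_t G t.
  rewrite brk_suml.
  rewrite -(pair_bigA _ (fun i j => (a 0 i * b 0 j) *: brk (e i) (e j))) /=.
  apply: eq_bigr => i _.
  rewrite linear_sum; apply: eq_bigr => j _.
  by rewrite linearZ /= brkZl scalerA mulrC.
rewrite (bigID (fun t : 'I_N * 'I_N => (t.1 < t.2)%N)) /=.
rewrite (bigID (fun t : 'I_N * 'I_N => t.1 == t.2) (fun t => ~~ _)) /=.
rewrite [RHS](bigID (fun t : 'I_N * 'I_N => (t.1 < t.2)%N)) /=.
rewrite addrCA addrC; congr (_ + _).
  (* The pairs i > j are folded onto the pairs i < j by skew-symmetry. *)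
  rewrite [X in _ + X](reindex_inj (inv_inj (_ : involutive (fun t => (t.2, t.1)))));
    last by case.
  rewrite /= [X in _ + X](eq_bigl (fun t : 'I_N * 'I_N => (t.1 < t.2)%N)); last first.
    by case=> i j /=; rewrite -val_eqE /=; lia.
  rewrite -big_split /= [RHS](eq_bigl (fun t : 'I_N * 'I_N => (t.1 < t.2)%N)); last first.
    by case=> i j; rewrite unfold_in /=; case: (i < j)%N; rewrite ?andbF.
  apply: eq_bigr => -[i j] /= ij.
  rewrite /G /wedge /= (_ : i == j = false); last by rewrite -val_eqE /=; lia.
  rewrite (brk_skew _ _ _ _ (eP j) (eP i)) scalerBl scalerN scalerA andbC.
  by congr (_ - _ *: _); ring.
rewrite (eq_bigl (fun t : 'I_N * 'I_N => t.1 == t.2)); last first.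
  by case=> i j /=; case: eqP => [->|]; rewrite ?ltnn ?andbF.
rewrite [RHS](eq_bigl (fun t : 'I_N * 'I_N => (t.1 == t.2) && deg t.1)); last first.
  case=> i j; rewrite unfold_in /=.
  by case: eqP => [->|]; rewrite ?ltnn ?orbF ?andbT // ?andbN.
rewrite (bigID (fun t : 'I_N * 'I_N => deg t.1)) /= [X in _ + X]big1 ?addr0.
  by apply: eq_bigr => -[i j] /= /andP[/eqP <- _]; rewrite /G /wedge /= eqxx.
case=> i j /= /andP[/eqP <- /negPf di].
by rewrite /G /= brk_even_alt ?scaler0 //; have := eP i; rewrite di.
Qed.

(** A homogeneous basis of L, e_i of degree [deg i], with its coordinate
    functions. *)
Record hbasis (K : fieldType) (L : lieSuperType K) N (deg : 'I_N -> bool) :=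
  HBasis {
    bas : 'I_N -> L;
    coords : {linear L -> 'rV[K]_N};
    bas_grade : forall i, grade (deg i) (bas i);
    coordsK : forall x, x = \sum_i coords x 0 i *: bas i;
    coords_bas : forall i, coords (bas i) = delta_mx 0 i;
    coords_grade : forall b x i, grade b x -> deg i != b -> coords x 0 i = 0 }.

Lemma superdim_hbasis (K : fieldType) (L : lieSuperType K) m n :
  superdim L m n -> inhabited (hbasis L (fun i : 'I_(m + n) => (m <= i)%N)).
Proof.
case=> [[u [gu su iu]] [v [gv sv iv]]].
pose e (i : 'I_(m + n)) := match split i with inl j => u j | inr j => v j end.
have el j : e (lshift n j) = u j by rewrite /e (unsplitK (inl j)).
have er j : e (rshift m j) = v j by rewrite /e (unsplitK (inr j)).
have eg (i : 'I_(m + n)) : grade (m <= i)%N (e i).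
  rewrite /e; case: splitP => j ->.
    by rewrite leqNgt ltn_ord; exact: gu.
  by rewrite leq_addr; exact: gv.
have sumE (c : 'I_(m + n) -> K) : \sum_i c i *: e i =
    \sum_i c (lshift n i) *: u i + \sum_i c (rshift m i) *: v i.
  by rewrite big_split_ord /=; congr (_ + _); apply: eq_bigr => i _; rewrite ?el ?er.
have sL b := grade_subspace (s := L) b.
(* A dependence relation between the e_i splits into its two homogeneous
   parts. *)
have eind (c : 'I_(m + n) -> K) : \sum_i c i *: e i = 0 -> forall i, c i = 0.
  rewrite sumE => c0.
  have g0 : grade false (\sum_i c (lshift n i) *: u i).
    by apply: subspace_sum => // i _; apply: subspaceZ.
  have g1 : grade true (\sum_i c (rshift m i) *: v i).
    by apply: subspace_sum => // i _; apply: subspaceZ.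
  have z0 := grade_add_homog g0 g1.
  rewrite c0 in z0.
  have z1 := z0 true (grade0 _ _); have z2 := z0 false (grade0 _ _).
  move=> i; case: (split_ordP i) => j ->.
    by apply: (iu (fun j => c (lshift n j))).
  by apply: (iv (fun j => c (rshift m j))).
have esp b x : grade b x -> exists c : 'rV[K]_(m + n),
    x = \sum_i c 0 i *: e i /\ forall i : 'I_(m + n), (m <= i)%N != b -> c 0 i = 0.
  case: b => gx; [have [c /eqP cx] := sv _ gx|have [c /eqP cx] := su _ gx].
    exists (row_mx 0 (\row_i c i)); split.
      rewrite sumE [X in X + _]big1 => [|i _]; last by rewrite row_mxEl mxE scale0r.
      rewrite add0r; apply/eqP; rewrite -subr_eq0.
      by under eq_bigr do rewrite row_mxEr mxE.
    move=> i; case: (split_ordP i) => j ->; first by rewrite row_mxEl mxE.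
    by rewrite /= leq_addr.
  exists (row_mx (\row_i c i) 0); split.
    rewrite sumE [X in _ + X]big1 => [|i _]; last by rewrite row_mxEr mxE scale0r.
    rewrite addr0; apply/eqP; rewrite -subr_eq0.
    by under eq_bigr do rewrite row_mxEl mxE.
  move=> i; case: (split_ordP i) => j ->; last by rewrite row_mxEr mxE.
  by rewrite /= leqNgt ltn_ord.
have ex x : exists c : 'rV[K]_(m + n), x = \sum_i c 0 i *: e i.
  have [x0 [x1 [/esp[c0 [-> _]] /esp[c1 [-> _]] ->]]] := grade_decomp x.
  by exists (c0 + c1); rewrite -big_split; apply: eq_bigr => i _; rewrite mxE scalerDl.
pose c x := sval (cid (ex x)).
have cE x : x = \sum_i c x 0 i *: e i := svalP (cid (ex x)).
have cU x (d : 'rV[K]_(m + n)) : x = \sum_i d 0 i *: e i -> c x = d.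
  move=> xd; apply/rowP => i; apply/eqP; rewrite -subr_eq0; apply/eqP.
  apply: (eind (fun i => c x 0 i - d 0 i)).
  by under eq_bigr do rewrite scalerBl; rewrite sumrB -cE -xd subrr.
have clin : linear c.
  move=> a x y; apply: cU; rewrite {1}(cE x) {1}(cE y) scaler_sumr -big_split.
  by apply: eq_bigr => i _; rewrite !mxE scalerDl scalerA.
pose cl : {linear L -> 'rV[K]_(m + n)} :=
  HB.pack c (GRing.isLinear.Build K _ _ _ c clin).
have cb i : cl (e i) = delta_mx 0 i.
  apply: cU; rewrite (bigD1 i) //= mxE !eqxx scale1r big1 ?addr0 // => j ji.
  by rewrite mxE (negPf ji) andbF scale0r.
have cg b x (i : 'I_(m + n)) : grade b x -> (m <= i)%N != b -> cl x 0 i = 0.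
  by move=> /esp[d [xd hd]] /hd; rewrite /= (cU _ _ xd).
exact: (inhabits (@HBasis _ _ _ _ e cl eg cE cb cg)).
Qed.

(** * The derived subalgebra modulo [R, F] *)

Section DerivedQuotient.
Variable K : fieldType.
Variables (L : lieSuperType K) (N : nat) (deg : 'I_N -> bool).
Variables (B : hbasis L deg) (P : free_presentation L).
Local Notation D := #|wpairs deg|.
Local Notation F := (fp_free P).
Local Notation p := (fp_map P).
Local Notation RF := (brk_set (fp_ker P) setT).
Local Notation FF := (brk_set (setT : set F) setT).

(** The super exterior product of x and y, as a row of coordinates. *)
Definition wedge_row (x y : L) : 'rV[K]_D :=
  \row_i wedge deg (coords B x) (coords B y) (enum_val i).

Lemma coords_inj : injective (coords B).
Proof. by move=> x y e; rewrite (coordsK B x) (coordsK B y) e. Qed.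

(** The brackets of lifts of basis vectors span [F, F] modulo [R, F], with the
    super exterior product giving the coordinates of a bracket. *)
Lemma wedge_span (char2 : 2%N \notin [pchar K]) : exists w : 'I_D -> F,
  (forall i, exists X Y, [/\ w i = brk X Y,
     p X = bas B (enum_val i).1 & p Y = bas B (enum_val i).2])
  /\ (forall s t, RF (brk s t - \sum_i wedge_row (p s) (p t) 0 i *: w i)).
Proof.
have /choice[e /all_and2[eg pe]] : forall i, exists x : F,
    grade (deg i) x /\ p x = bas B i.
  by move=> i; have [x gx px] := fp_lift P (bas_grade B i); exists x.
exists (fun i => brk (e (enum_val i).1) (e (enum_val i).2)); split.
  by move=> i; do 2!eexists; split; first by [].
move=> s t.
have pS (a : L) : p (\sum_i coords B a 0 i *: e i) = a.
  rewrite linear_sum [RHS](coordsK B a); apply: eq_bigr => i _.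
  by rewrite linearZ /= pe.
have := @brk_mod_ker _ _ P s t (\sum_i coords B (p s) 0 i *: e i)
  (\sum_i coords B (p t) 0 i *: e i) (esym (pS _)) (esym (pS _)).
rewrite (brk_wedge char2 eg) big_enum_val /=.
by under [in X in _ -> X]eq_bigr do rewrite mxE.
Qed.

(* A spanning family as given by the previous lemma. *)
Variable w : 'I_D -> F.
Hypothesis wbrk : forall i, exists X Y, [/\ w i = brk X Y,
  p X = bas B (enum_val i).1 & p Y = bas B (enum_val i).2].
Hypothesis wspan :
  forall s t, RF (brk s t - \sum_i wedge_row (p s) (p t) 0 i *: w i).
Local Notation lc c := (\sum_i (c : 'rV[K]_D) 0 i *: w i).

Let pw i : p (w i) = brk (bas B (enum_val i).1) (bas B (enum_val i).2).
Proof. by have [X [Y [-> <- <-]]] := wbrk i; rewrite fp_brk. Qed.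

Let sRF : subspace RF. Proof. exact: subspace_brk_set. Qed.

Lemma lcP (a : K) (c d : 'rV[K]_D) : lc (a *: c + d) = a *: lc c + lc d.
Proof.
rewrite scaler_sumr -big_split; apply: eq_bigr => i _.
by rewrite !mxE scalerDl scalerA.
Qed.

Lemma lc0 : lc 0 = 0.
Proof. by rewrite big1 // => i _; rewrite mxE scale0r. Qed.

Lemma lc_mul d (u : 'rV[K]_d) (A : 'M[K]_(d, D)) :
  lc (u *m A) = \sum_i u 0 i *: lc (row i A).
Proof.
under eq_bigr do rewrite mxE scaler_suml.
rewrite exchange_big; apply: eq_bigr => i _; rewrite scaler_sumr.
by apply: eq_bigr => j _; rewrite mxE scalerA.
Qed.

Lemma brk_set_span u : FF u -> exists c, RF (u - lc c).
Proof.
apply: (@brk_set_min _ _ _ _ [set u | exists c, RF (u - lc c)]%classic) => //.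
  apply/subspaceP; split=> [|a x y [c hc] [d hd]] /=.
    exists 0; rewrite lc0 subr0; exact: subspace0.
  exists (a *: c + d); rewrite lcP opprD addrACA -scalerBr.
  by apply: (subspaceD sRF) => //; apply: (subspaceZ _ sRF).
by move=> x y _ _; exists (wedge_row (p x) (p y)).
Qed.

Lemma fp_RF x y : RF (x - y) -> p x = p y.
Proof.
move/brk_set_ker_sub; rewrite /fp_ker /= linearB => /eqP.
by rewrite subr_eq0 => /eqP.
Qed.

(** When the spanning brackets are independent, the Jacobi identity of F
    becomes a relation in the exterior square of L. *)
Lemma wedge_jacobi : (forall c, RF (lc c) -> c = 0) ->
  forall a b c x y z, grade a x -> grade b y -> grade c z ->
    (-1) ^+ (a && c) *: wedge_row x (brk y z)
    + (-1) ^+ (b && a) *: wedge_row y (brk z x)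
    + (-1) ^+ (c && b) *: wedge_row z (brk x y) = 0.
Proof.
move=> winj a b c x y z /(fp_lift P)[X gX <-] /(fp_lift P)[Y gY <-].
move=> /(fp_lift P)[Z gZ <-]; apply: winj; rewrite -!fp_brk.
have J := brk_jacobi _ _ _ _ _ _ gX gY gZ.
set W1 := wedge_row _ _; set W2 := wedge_row _ _; set W3 := wedge_row _ _.
have -> : lc ((-1) ^+ (a && c) *: W1 + (-1) ^+ (b && a) *: W2
    + (-1) ^+ (c && b) *: W3) = (-1) ^+ (a && c) *: lc W1
    + (-1) ^+ (b && a) *: lc W2 + (-1) ^+ (c && b) *: lc W3.
  by rewrite -addrA !lcP addrA -[_ *: W3]addr0 lcP lc0 addr0.
rewrite -[X in RF X]opprK; apply: (subspaceN sRF).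
rewrite -[X in RF X]add0r -[X in RF (X + _)]J !opprD.
rewrite addrACA [X in RF (X + _)]addrACA -!scalerBr.
by apply: (subspaceD sRF); first apply: (subspaceD sRF);
  apply: (subspaceZ _ sRF); apply: wspan.
Qed.

(** A multiplier whose dimension is one less than that of the exterior square
    of a non-abelian L leaves no room: the spanning brackets are independent,
    and the derived subalgebra of L is a line. *)
Lemma multiplier_corank1 d : dim_multiplier P d -> D = d.+1 ->
  (exists x y : L, brk x y <> 0) ->
  (forall c, RF (lc c) -> c = 0) /\
  exists b (z : L), [/\ z <> 0, grade b z,
    exists i j, z = brk (bas B i) (bas B j)
    & forall x y : L, exists k : K, brk x y = k *: z].
Proof.
move=> [v [vM vS vI]] Dd [x0 [y0 nz0]].
have /choice[A0 vA] : forall i, exists c, RF (v i - lc c).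
  by move=> i; apply: brk_set_span; case: (vM i).
pose A := \matrix_i A0 i; pose Bm := \matrix_i coords B (p (w i)).
have lcB c : c *m Bm = coords B (p (lc c)).
  rewrite mulmx_sum_row !linear_sum; apply: eq_bigr => i _.
  by rewrite rowK !linearZ.
have lcB0 c : RF (lc c) -> c *m Bm = 0.
  by move=> /brk_set_ker_sub h; rewrite lcB h linear0.
have AB : A *m Bm = 0.
  apply/row_matrixP => i; rewrite row_mul row0 rowK lcB.
  rewrite -(fp_RF (vA i)); have [kv _] := vM i.
  by rewrite kv linear0.
have Bm0 : Bm != 0.
  apply/eqP => B0; apply: nz0.
  have [[X <-] [Y <-]] := (fp_surj P x0, fp_surj P y0).
  rewrite -fp_brk (fp_RF (wspan X Y)); apply: coords_inj.
  by rewrite -lcB B0 mulmx0 linear0.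
have vRF (u : 'rV[K]_d) : RF (lc (u *m A)) -> u = 0.
  move=> h; apply/rowP => i; rewrite mxE; apply: (vI (fun i => u 0 i)).
  rewrite -[X in RF X](subrK (lc (u *m A))).
  apply: (subspaceD sRF) => //; rewrite lc_mul -sumrB.
  apply: (subspace_sum _ sRF) => j _; rewrite -scalerBr rowK.
  exact: (subspaceZ _ sRF).
(* A holds the coordinates of a basis of M(L) and Bm those of the bracket map
   to L, so A *m Bm = 0 bounds the rank of Bm by D - d = 1. *)
have rA : \rank A = d.
  apply/eqP/inj_row_free => u uA; apply: vRF; rewrite uA lc0.
  exact: subspace0.
split.
  (* A non-trivial relation c would be one more independent row in the kernel
     of Bm, forcing Bm = 0. *)
  move=> c hc; apply/eqP/negPn/negP => c0.
  have rAc : \rank (col_mx A c) = (d + 1)%N.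
    apply/eqP/inj_row_free => u.
    rewrite -[u]hsubmxK mul_row_col => e.
    suff u0 : lsubmx u = 0.
      move: e; rewrite u0 mul0mx add0r [rsubmx u]mx11_scalar mul_scalar_mx.
      move/eqP; rewrite scaler_eq0 (negPf c0) orbF => /eqP ->.
      by rewrite -scalemx1 scale0r row_mx0.
    apply: vRF; move: e; rewrite [rsubmx u]mx11_scalar mul_scalar_mx addrC.
    move/eqP; rewrite addr_eq0 => /eqP e.
    have -> : lsubmx u *m A = (- (rsubmx u 0 0)) *: c + 0.
      by rewrite addr0 scaleNr e opprK.
    rewrite lcP; apply: (subspaceD sRF); first exact: (subspaceZ _ sRF).
    by rewrite lc0; apply: subspace0.
  have := mulmx0_rank_max (_ : col_mx A c *m Bm = 0).
  rewrite rAc mul_col_mx AB lcB0 // col_mx0 => /(_ erefl).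
  have rB : (0 < \rank Bm)%N by rewrite lt0n mxrank_eq0.
  by lia.
have rB : (\rank Bm <= 1)%N.
  by have := mulmx0_rank_max AB; rewrite rA; lia.
have [k Bk] : exists k, row k Bm != 0.
  apply/existsP; rewrite -negb_forall; apply: contra Bm0 => /forallP h.
  by apply/eqP/row_matrixP => i; rewrite row0; apply/eqP.
have subB : (Bm <= row k Bm)%MS.
  have [_ <-] := mxrank_leqif_sup (row_sub k Bm).
  have := mxrankS (row_sub k Bm); rewrite rank_rV Bk => rB1.
  by apply/eqP; lia.
exists (deg (enum_val k).1 (+) deg (enum_val k).2), (p (w k)); split.
- by move=> h; move: Bk; rewrite rowK h linear0 eqxx.
- by rewrite pw; apply: brk_grade; apply: bas_grade.
- by rewrite pw; do 2!eexists.
move=> x y; have [[X <-] [Y <-]] := (fp_surj P x, fp_surj P y).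
rewrite -fp_brk (fp_RF (wspan X Y)).
set c := wedge_row _ _.
have : (c *m Bm <= row k Bm)%MS by apply: submx_trans (submxMl _ _) subB.
case/sub_rVP => a; rewrite lcB rowK -linearZ => /coords_inj e.
by exists a.
Qed.

End DerivedQuotient.

(** * Abelian Lie superalgebras *)

Section Abelian.
Variables (K : fieldType) (char2 : 2%N \notin [pchar K]).
Variables (L : lieSuperType K) (N : nat) (deg : 'I_N -> bool).
Variables (B : hbasis L deg) (P : free_presentation L).
Hypothesis abL : forall x y : L, brk x y = 0.
Local Notation D := #|wpairs deg|.

(** On an abelian L, the coordinates of the super exterior product are
    homogeneous cocycles. *)
Lemma wedge_cocycle (s : 'I_N * 'I_N) : wpairs deg s ->
  exists b (w : cocycle L b),
    forall x y, cocy w x y = wedge deg (coords B x) (coords B y) s.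
Proof.
case: s => i j ps; pose c (x y : L) := wedge deg (coords B x) (coords B y) (i, j).
have cl z a x y : c (a *: x + y) z = a * c x z + c y z.
  by rewrite /c linearP wedge_linl.
have cr z a x y : c z (a *: x + y) = a * c z x + c z y.
  by rewrite /c linearP wedge_linr.
have degs a b x y : grade a x -> grade b y ->
    (a (+) b != deg i (+) deg j -> c x y = 0)
    /\ c x y = - ((-1) ^+ (a && b) * c y x).
  move=> gx gy; rewrite /c /wedge /=.
  have X k : deg k != a -> coords B x 0 k = 0 := coords_grade B gx (i := k).
  have Y k : deg k != b -> coords B y 0 k = 0 := coords_grade B gy (i := k).
  have := X i; have := X j; have := Y i; have := Y j.
  move: ps; rewrite /wpairs /=; case: eqP => [<-|_].
    rewrite ltnn /= => ->.
    case: (a) (b) => [] [] /=;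
    do ?[move=> /(_ isT) -> | move=> _];
    by split=> //; try move=> _; rewrite ?expr0 ?expr1; ring.
  move=> _; case: (deg i) (deg j) (a) (b) => [] [] [] [] /=;
  do ?[move=> /(_ isT) -> | move=> _];
  by split=> //; try move=> _; rewrite ?expr0 ?expr1; ring.
have cj a b d x y z : grade a x -> grade b y -> grade d z ->
    (-1) ^+ (a && d) * c x (brk y z) + (-1) ^+ (b && a) * c y (brk z x)
    + (-1) ^+ (d && b) * c z (brk x y) = 0.
  have c0 u : c u 0 = 0.
    by have := cr u (-1) 0 0; rewrite scaler0 addr0 mulN1r addNr.
  by rewrite !abL !c0 !mulr0 !addr0.
exists (deg i (+) deg j).
by exists (Cocycle cl cr (fun a b x y gx gy => proj1 (degs a b x y gx gy))
  (fun a b x y gx gy => proj2 (degs a b x y gx gy)) cj).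
Qed.

(** The multiplier of an abelian L is at least as large as its super exterior
    square. *)
Lemma abelian_multiplier_ge d : dim_multiplier P d -> (D <= d)%N.
Proof.
move=> [v [vM vS _]].
have [w [wbrk _]] := wedge_span B P char2.
have /choice[A wA] : forall i, exists c : 'I_d -> K,
    brk_set (fp_ker P) setT (w i - \sum_j c j *: v j).
  by move=> i; apply: vS; have [X [Y [-> _ _]]] := wbrk i; split;
    [rewrite /fp_ker /= fp_brk abL|exact: (@brk_set_brk _ _ setT setT)].
have /choice[phi phiP] : forall s : 'I_D,
    exists phi : {linear fp_free P -> K^o},
    (forall u, brk_set (fp_ker P) setT u -> phi u = 0) /\
    forall t, phi (w t) = (s == t)%:R.
  move=> s; have [b [c cE]] := wedge_cocycle (enum_valP s).
  have [phi phiE] := cocycle_functional P c.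
  have phi0 := functional_ker phiE.
  exists phi; split=> // t; have [X [Y [-> pX pY]]] := wbrk t.
  by rewrite phiE cE pX pY !coords_bas wedge_delta ?(inj_eq enum_val_inj) //;
    apply: (enum_valP (A := wpairs deg)).
pose Am := \matrix_(i, j) A i j; pose Ph := \matrix_(j, s) phi s (v j).
(* The identity of size D factors through a space of dimension d. *)
have AP : Am *m Ph = 1%:M.
  apply/matrixP => i s; rewrite !mxE.
  have := (phiP s).1 _ (wA i); rewrite linearB (phiP s).2 linear_sum => /eqP.
  rewrite subr_eq0 eq_sym [s == i]eq_sym => /eqP <-; apply: eq_bigr => j _.
  by rewrite !mxE linearZ.
have := mxrankM_maxl Am Ph; rewrite AP mxrank1 => /leq_trans; apply.
exact: rank_leq_col.
Qed.

End Abelian.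

(** * A characterisation of the Heisenberg algebra *)

Section HeisenbergCharacterisation.
Variables (K : fieldType).
Hypotheses (char2 : 2%N \notin [pchar K]) (char3 : 3%N \notin [pchar K]).
Variables (L : lieSuperType K) (N : nat) (deg : 'I_N -> bool).
Variable B : hbasis L deg.
Local Notation W := (wedge_row B).
Implicit Types x y w : L.

Lemma wedge_row_linl z a x y : W (a *: x + y) z = a *: W x z + W y z.
Proof. by apply/rowP => i; rewrite !mxE linearP wedge_linl. Qed.

Lemma wedge_row_Zr z a x : W z (a *: x) = a *: W z x.
Proof.
apply/rowP => i; rewrite !mxE -[a *: x]addr0 linearP wedge_linr linear0.
by rewrite /wedge !mxE !mulr0 subr0 if_same addr0.
Qed.

Lemma wedge_row_0r z : W z 0 = 0.
Proof. by rewrite -(scale0r 0) wedge_row_Zr scale0r. Qed.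

(** If z is homogeneous and non-zero and x /\ z = 0, then x is a multiple of z;
    if moreover z is odd then x = 0, because z /\ z <> 0. *)
Lemma wedge_row_eq0 b x z : grade b z -> z <> 0 -> W x z = 0 ->
  (exists k, x = k *: z) /\ (b -> x = 0).
Proof.
move=> gz z0 Wxz; set X := coords B x; set Z := coords B z.
have [j Zj] : exists j, Z 0 j != 0.
  apply/existsP; rewrite -negb_forall; apply/negP => /forallP h.
  apply: z0; apply: (@coords_inj _ _ _ _ B); rewrite linear0.
  by apply/rowP => i; rewrite mxE; apply/eqP.
have dj : deg j = b.
  by apply/eqP/negPn/negP => /(coords_grade B gz) h; rewrite /Z h eqxx in Zj.
have Wt t : wpairs deg t -> wedge deg X Z t = 0.
  move=> pt; have := congr1 (fun r : 'rV_ _ => r 0 (enum_rank_in (pt : t \in wpairs deg) t)) Wxz.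
  by rewrite !mxE enum_rankK_in.
have rel i : i != j -> X 0 i * Z 0 j = (-1) ^+ (deg i && deg j) * (X 0 j * Z 0 i).
  move=> ij; have [lij|lji|e] := ltngtP i j; last by rewrite (val_inj e) eqxx in ij.
    have := Wt (i, j); rewrite /wpairs /wedge /= lij (negPf ij) => /(_ isT)/eqP.
    by rewrite subr_eq0 => /eqP.
  have := Wt (j, i); rewrite /wpairs /wedge /= lji eq_sym (negPf ij) => /(_ isT)/eqP.
  by rewrite subr_eq0 andbC => /eqP ->; rewrite mulrA -signr_addb addbb mul1r.
have XZ (k : K) : X = k *: Z -> x = k *: z.
  by move=> e; apply: (@coords_inj _ _ _ _ B); rewrite linearZ.
case: b gz dj => gz dj.
  have Xj : X 0 j = 0.
    have := Wt (j, j); rewrite /wpairs /wedge /= eqxx dj orbT => /(_ isT)/eqP.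
    by rewrite mulf_eq0 (negPf Zj) orbF => /eqP.
  have x0 : x = 0.
    rewrite -(scale0r z); apply: XZ; rewrite scale0r; apply/rowP => i; rewrite mxE.
    have [->//|/rel] := eqVneq i j.
    by rewrite Xj mul0r mulr0 => /eqP; rewrite mulf_eq0 (negPf Zj) orbF => /eqP.
  by split=> // ; exists 0; rewrite scale0r.
split=> //; exists (X 0 j / Z 0 j); apply: XZ; apply/rowP => i; rewrite mxE.
apply: (mulIf Zj); rewrite mulrAC divfK //.
by have [->//|/rel] := eqVneq i j; rewrite dj andbF expr0 mul1r.
Qed.

(* The Jacobi identity in the super exterior square, and a homogeneous central
   z whose line contains all brackets. *)
Hypothesis jac : forall a b c x y z, grade a x -> grade b y -> grade c z ->
  (-1) ^+ (a && c) *: W x (brk y z) + (-1) ^+ (b && a) *: W y (brk z x)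
  + (-1) ^+ (c && b) *: W z (brk x y) = 0.
Variables (e : bool) (z : L).
Hypotheses (gz : grade e z) (z0 : z <> 0).
Hypothesis line : forall x y : L, exists k : K, brk x y = k *: z.
Hypotheses (zcl : forall x, brk z x = 0) (zcr : forall x, brk x z = 0).

Lemma wedge_z_eq0 a x : grade a x -> a || e -> W x z = 0 -> x = 0.
Proof.
move=> gx ae /(wedge_row_eq0 gz z0)[[k xk] xe].
case: e ae xe gz => [_ /(_ isT)//|]; rewrite orbF => ha _ ge.
rewrite ha in gx; apply: grade_disjoint => //.
by rewrite xk; apply: subspaceZ => //; apply: grade_subspace.
Qed.

(** Jacobi at (x, x, x) reads 3 x /\ [x, x] = 0. *)
Lemma brk_odd_sq x : grade true x -> brk x x = 0.
Proof.
move=> gx; have := jac gx gx gx; have [k xx] := line x x.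
rewrite xx wedge_row_Zr /= expr1 !scaleN1r -!opprD => /eqP.
rewrite oppr_eq0 -mulr2n -mulrSr -scaler_nat.
move=> /eqP/(@scaler_nat_eq0 _ _ 3 _ isT char3)/eqP.
rewrite scaler_eq0 => /orP[/eqP ->|/eqP/(wedge_z_eq0 gx isT) x0].
  by rewrite scale0r.
by rewrite -xx x0 brk0l.
Qed.

(** By polarization. *)
Lemma brk_odd_odd x y : grade true x -> grade true y -> brk x y = 0.
Proof.
move=> gx gy.
have gxy : grade true (x + y).
  by apply: subspaceD => //; apply: grade_subspace.
have := brk_odd_sq gxy; rewrite brkDl !linearD /= !brk_odd_sq // add0r addr0.
rewrite (brk_skew _ _ _ _ gy gx) /= expr1 scaleN1r opprK -mulr2n -scaler_nat.
exact: (@scaler_nat_eq0 _ _ 2).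
Qed.

(** Jacobi at (x, y, y) reads 2 y /\ [x, y] = 0, up to sign. *)
Lemma brk_even_odd x y : grade false x -> grade true y -> brk x y = 0.
Proof.
move=> gx gy; have := jac gx gy gy; rewrite brk_odd_sq // wedge_row_0r scaler0.
have [k xy] := line x y.
rewrite (brk_skew _ _ _ _ gy gx) /= !expr0 !expr1 !scale1r scaleN1r add0r xy.
rewrite -scaleNr !wedge_row_Zr scaleNr -opprD => /eqP.
rewrite oppr_eq0 -mulr2n -scaler_nat.
move=> /eqP/(@scaler_nat_eq0 _ _ 2 _ isT char2)/eqP.
rewrite scaler_eq0 => /orP[/eqP ->|/eqP/(wedge_z_eq0 gy isT) y0].
  by rewrite scale0r.
by rewrite -xy y0 linear0.
Qed.

Lemma brk_odd_even x y : grade true x -> grade false y -> brk x y = 0.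
Proof.
by move=> gx gy; rewrite (brk_skew _ _ _ _ gx gy) brk_even_odd // scaler0 oppr0.
Qed.

(** When [L, L] is a central line spanned by z = [x, y] and the Jacobi identity
    holds in the super exterior square, x and y are even and L is the Heisenberg
    algebra with basis x, y, z. *)
Lemma heisenberg_char a b x y : grade a x -> grade b y -> z = brk x y ->
  lie_isom L (heisenberg K).
Proof.
move=> gx gy zxy.
have [ea eb] : a = false /\ b = false.
  case: a b gx gy => [] [] gx gy //; exfalso; apply: z0; rewrite zxy.
  - exact: brk_odd_odd.
  - exact: brk_odd_even.
  - exact: brk_even_odd.
subst a b.
have ge : grade false z by rewrite zxy; exact: (brk_grade _ _ _ _ gx gy).
(* Jacobi at (w, x, y) reads w /\ z = 0. *)
have odd0 w : grade true w -> w = 0.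
  move=> gw; have := jac gw gx gy; rewrite -zxy brk_even_odd // brk_odd_even //.
  by rewrite !wedge_row_0r !scaler0 !addr0 expr0 scale1r => /(wedge_z_eq0 gw isT).
pose g (v : heisenberg K) : L :=
  (v : 'rV_3) 0 0 *: x + (v : 'rV_3) 0 1 *: y + (v : 'rV_3) 0 2 *: z.
(* Jacobi at (w, x, y) puts a combination w + k1 x + k2 y on the line of z. *)
have even w : grade false w -> exists v, w = g v.
  move=> gw; have := jac gw gx gy; rewrite -zxy.
  have [k1 ->] := line y w; have [k2 ->] := line w x.
  rewrite /= !scale1r !wedge_row_Zr => h.
  have : W (k1 *: x + (k2 *: y + w)) z = 0.
    by rewrite !wedge_row_linl addrA addrC addrA.
  move/(wedge_row_eq0 ge z0) => [[k3 h3] _].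
  exists (\row_i [:: - k1; - k2; k3]`_i : 'rV_3).
  rewrite /g !mxE /= -h3 !scaleNr -opprD.
  by rewrite [k1 *: x + _]addrA addKr.
have sp w : exists v, w = g v.
  have [w0 [w1 [h0 /odd0 -> ->]]] := grade_decomp w; rewrite addr0; exact: even.
have xx : brk x x = 0 by exact: brk_even_alt.
have yy : brk y y = 0 by exact: brk_even_alt.
have yx : brk y x = - z by rewrite zxy; exact: brk_even_skew.
have gbrk u v : brk (g u) (g v) = g (brk u v).
  have -> : brk u v = ((u : 'rV_3) 0 0 * (v : 'rV_3) 0 1
    - (u : 'rV_3) 0 1 * (v : 'rV_3) 0 0) *: heis_z K by [].
  rewrite /g !mxE /= !mulr0 mulr1 !scale0r !add0r.
  rewrite !brkDl !brkZl !linearD !linearZ /= xx yy yx -zxy !zcl !zcr.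
  rewrite !scaler0 !addr0 !add0r !scalerN !scalerA scalerBl.
  by congr (_ *: _ - _); rewrite mulrC.
have glin : linear g.
  move=> a u v; rewrite /g !mxE !scalerDl !scalerDr !scalerA.
  by rewrite [X in X + _ = _]addrACA [LHS]addrACA.
have g0 v : g v = 0 -> v = 0.
  move=> gv.
  (* Bracketing with y and with x isolates the first two coordinates. *)
  have := congr1 (brk x) gv; have := congr1 (brk y) gv.
  rewrite !linear0 /g !linearD !linearZ /= xx yy yx -zxy !zcr !scaler0 !addr0 add0r.
  move=> /eqP; rewrite scalerN oppr_eq0 scaler_eq0 => /orP[/eqP v0|/eqP//].
  move=> /eqP; rewrite scaler_eq0 => /orP[/eqP v1|/eqP//].
  move: gv => /eqP; rewrite /g v0 v1 !scale0r !add0r scaler_eq0 => /orP[/eqP v2|/eqP//].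
  apply/rowP => i; rewrite mxE; case: i => [[|[|[|//]]] i3].
  - by rewrite -[RHS]v0; congr (_ _ _); apply: val_inj.
  - by rewrite -[RHS]v1; congr (_ _ _); apply: val_inj.
  - by rewrite -[RHS]v2; congr (_ _ _); apply: val_inj.
pose gl : {linear heisenberg K -> L} :=
  HB.pack g (GRing.isLinear.Build K (heisenberg K) L _ g glin).
have gs w : g (sval (cid (sp w))) = w by case: cid.
apply: lie_isom_sym; exists gl; last first.
  exists (fun w => sval (cid (sp w))) => [v|w]; last exact: gs.
  by apply/eqP; rewrite -subr_eq0; apply/eqP/g0; rewrite [LHS](linearB gl) /= gs subrr.
split=> [[] v /=|u v]; last by rewrite /= gbrk.
  by move=> ->; rewrite [g 0](linear0 gl); apply: grade0.
move=> _; have sg := grade_subspace (s := L) false.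
by do 2?[apply: (subspaceD sg)]; apply: (subspaceZ _ sg).
Qed.

End HeisenbergCharacterisation.

(** * Nilpotency *)

(** An eigenvector of [-, x] with non-zero eigenvalue lies in the whole lower
    central series. *)
Lemma lcs_eigen (K : fieldType) (L : lieSuperType K) (z x : L) (k : K) i :
  brk z x = k *: z -> k != 0 -> lcs L i z.
Proof.
move=> zx k0; elim: i => [//|i IH].
have -> : z = k^-1 *: brk z x by rewrite zx scalerK.
apply: (subspaceZ _ (subspace_brk_set (lcs L i) setT)).
exact: (brk_set_brk IH I).
Qed.

(** In a nilpotent Lie superalgebra whose brackets all lie on the line of a
    homogeneous z, the vector z is central: it is an eigenvector of every
    operator [-, x], and these are nilpotent. *)
Lemma nilpotent_line_central (K : fieldType) (L : lieSuperType K) b (z : L) :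
  nilpotent L -> grade b z -> (forall x y : L, exists k : K, brk x y = k *: z) ->
  forall x, brk z x = 0 /\ brk x z = 0.
Proof.
move=> [i nil] gz line.
have zl x : brk z x = 0.
  have [k zx] := line z x; have [k0|k0] := eqVneq k 0.
    by rewrite zx k0 scale0r.
  have := lcs_eigen i zx k0; rewrite nil => z0.
  by rewrite z0 brk0l.
move=> x; split=> //; have [x0 [x1 [h0 h1 ->]]] := grade_decomp x.
rewrite brkDl (brk_skew _ _ _ _ h0 gz) (brk_skew _ _ _ _ h1 gz) !zl.
by rewrite !scaler0 !oppr0 addr0.
Qed.

(** * The multiplier of the Heisenberg algebra *)

Section HeisenbergMultiplier.
Variables (K : fieldType) (char2 : 2%N \notin [pchar K]).
Local Notation H := (heisenberg K).

(** The exterior product of the coordinate form of index k (0 for x1, 1 for x2)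
    with that of z is a cocycle. *)
Lemma heis_cocycle (k : 'I_3) : exists w : cocycle H false, forall u v : H,
  cocy w u v = (u : 'rV_3) 0 k * (v : 'rV_3) 0 2 - (u : 'rV_3) 0 2 * (v : 'rV_3) 0 k.
Proof.
pose c (u v : H) := (u : 'rV_3) 0 k * (v : 'rV_3) 0 2
  - (u : 'rV_3) 0 2 * (v : 'rV_3) 0 k.
have cl z a x y : c (a *: x + y) z = a * c x z + c y z.
  by rewrite /c !mxE; ring.
have cr z a x y : c z (a *: x + y) = a * c z x + c z y.
  by rewrite /c !mxE; ring.
have c0 x : c 0 x = 0 by rewrite /c !mxE !mul0r subr0.
have c0r x : c x 0 = 0 by rewrite /c !mxE !mulr0 subr0.
have cg a b (x y : H) : grade a x -> grade b y -> a (+) b != false -> c x y = 0.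
  by case: a b => [] [] //=; [move=> -> _ _|move=> _ ->].
have cs a b (x y : H) : grade a x -> grade b y ->
    c x y = - ((-1) ^+ (a && b) * c y x).
  case: a => /= [->|_ _]; first by rewrite c0 c0r mulr0 oppr0.
  by rewrite expr0 mul1r /c; ring.
have cj a b d (x y z : H) : grade a x -> grade b y -> grade d z ->
    (-1) ^+ (a && d) * c x (brk y z) + (-1) ^+ (b && a) * c y (brk z x)
    + (-1) ^+ (d && b) * c z (brk x y) = 0.
  have bz (u : H) : brk 0 u = 0 :> H by exact: brk0l.
  have zb (u : H) : brk u 0 = 0 :> H by exact: linear0.
  case: a => /= [-> _ _|_]; first by rewrite c0 bz zb !c0r !mulr0 !addr0.
  case: b => /= [-> _|_]; first by rewrite c0 bz zb !c0r !mulr0 !addr0.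
  case: d => /= [->|_]; first by rewrite c0 bz zb !c0r !mulr0 !addr0.
  rewrite !expr0 !mul1r /c /brk /= /heis_brk !mxE /=.
  have k3 : [\/ k = 0, k = 1 | k = 2].
    case: k {c cl cr c0 c0r cg cs} => [[|[|[|//]]] ki];
      [apply: Or31|apply: Or32|apply: Or33]; exact: val_inj.
  by case: k3 => ->; rewrite /= ?mulr1 ?mulr0; ring.
by exists (Cocycle cl cr cg cs cj).
Qed.

Lemma heis_multiplier (P : free_presentation H) : dim_multiplier P 2.
Proof.
have sRF := subspace_brk_set (fp_ker P) setT.
have [X1 g1 p1] := fp_lift P (I : grade false (heis_x1 K)).
have [X2 g2 p2] := fp_lift P (I : grade false (heis_x2 K)).
pose Z := brk X1 X2.
have gZ : grade false Z := brk_grade _ _ _ _ g1 g2.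
have pZ : fp_map P Z = heis_z K by rewrite fp_brk p1 p2 heis_brk12.
pose X (i : 'I_2) := if i == 0 then X1 else X2.
have pX i : fp_map P (brk (X i) Z) = 0.
  rewrite fp_brk pZ /X; case: ifP => _; rewrite ?p1 ?p2.
    exact: heis_brk1z.
  exact: heis_brk2z.
(* S is the span of Z, [X1, Z] and [X2, Z], plus [R, F]. *)
pose S : set (fp_free P) := [set u | exists a (c : 'I_2 -> K),
  brk_set (fp_ker P) setT (u - (a *: Z + \sum_i c i *: brk (X i) Z))]%classic.
have sS : subspace S.
  apply/subspaceP; split=> [|k u v [a [c hu]] [b [e hv]]].
    exists 0, (fun=> 0); rewrite scale0r !add0r big1 ?oppr0 => [|i _].
      exact: subspace0 sRF.
    by rewrite scale0r.
  exists (k * a + b), (fun i => k * c i + e i).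
  have -> : (k * a + b) *: Z + \sum_i (k * c i + e i) *: brk (X i) Z
      = k *: (a *: Z + \sum_i c i *: brk (X i) Z)
        + (b *: Z + \sum_i e i *: brk (X i) Z).
    rewrite scalerDr addrACA scalerA -scalerDl scaler_sumr -big_split.
    by congr (_ + _); apply: eq_bigr => i _; rewrite scalerDl scalerA.
  rewrite opprD addrACA -scalerBr.
  by apply: (subspaceD sRF) => //; apply: (subspaceZ _ sRF).
have SR u : brk_set (fp_ker P) setT u -> S u.
  move=> hu; exists 0, (fun=> 0); rewrite scale0r add0r big1 ?subr0 // => i _.
  by rewrite scale0r.
have SZ : S Z.
  exists 1, (fun=> 0); rewrite scale1r big1 => [|i _]; last by rewrite scale0r.
  by rewrite addr0 subrr; apply: (subspace0 sRF).
have SX i : S (brk (X i) Z).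
  exists 0, (fun j => (j == i)%:R); rewrite scale0r add0r (bigD1 i) //= eqxx.
  rewrite scale1r big1 => [|j /negPf->]; last by rewrite scale0r.
  by rewrite addr0 subrr; apply: (subspace0 sRF).
have gX i : grade false (X i) by rewrite /X; case: ifP.
have SX1 : S (brk X1 Z) := SX 0.
have SX2 : S (brk X2 Z) := SX 1.
have span : (brk_set setT setT `<=` S)%classic.
  apply: brk_set_min => // s t _ _.
  pose l (v : H) : fp_free P :=
    (v : 'rV_3) 0 0 *: X1 + (v : 'rV_3) 0 1 *: X2 + (v : 'rV_3) 0 2 *: Z.
  have lP v : fp_map P (l v) = v.
    rewrite !linearD !linearZ /= p1 p2 pZ; apply/rowP => i; rewrite !mxE.
    case: i => [[|[|[|//]]] i3]; rewrite /= ?mulr1 ?mulr0 ?addr0 ?add0r;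
      by congr (_ _ _); apply: val_inj.
  have /SR := @brk_mod_ker _ _ P s t (l (fp_map P s)) (l (fp_map P t))
    (esym (lP _)) (esym (lP _)).
  move=> /(subspaceD sS) hS.
  rewrite -[brk s t](subrK (brk (l (fp_map P s)) (l (fp_map P t)))); apply: hS.
  rewrite /l !brkDl !brkZl !linearD !linearZ /=.
  rewrite !brk_even_alt // (brk_even_skew g2 g1).
  rewrite (brk_even_skew gZ g1) (brk_even_skew gZ g2).
  by do ?[exact: (subspace0 sS)|apply: (subspaceD sS)|apply: (subspaceZ _ sS)|
    apply: (subspaceN sS)].
have h j : exists phi : {linear fp_free P -> K^o},
    (forall u, brk_set (fp_ker P) setT u -> phi u = 0) /\
    forall i : 'I_2, phi (brk (X i) Z) = (i == j)%:R.
  have [c cE] := heis_cocycle (widen_ord (isT : 2 <= 3)%N j).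
  have [phi phiE] := cocycle_functional P c.
  exists phi; split; first exact: functional_ker phiE.
  move=> i; rewrite phiE cE pZ /X.
  case: i j {c cE phi phiE} => [[|[|//]] ii] [[|[|//]] jj];
    rewrite /= ?p1 ?p2 !mxE /= ?mulr1 ?mulr0 ?mul0r ?mul1r ?subr0 ?sub0r //.
exists (fun i => brk (X i) Z); split.
- move=> i; split; first exact: pX.
  exact: (@brk_set_brk _ _ setT setT).
- move=> u [ku /span[a [c ha]]]; exists c.
  suff a0 : a = 0 by rewrite a0 scale0r add0r in ha.
  have := brk_set_ker_sub ha; rewrite /fp_ker /= linearB ku linearD linearZ /= pZ.
  rewrite linear_sum big1 => [|i _]; last by rewrite linearZ /= pX scaler0.
  rewrite addr0 sub0r => /eqP; rewrite oppr_eq0 scaler_eq0.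
  move=> /orP[/eqP//|/eqP/rowP/(_ 2)/eqP].
  by rewrite !mxE /= oner_eq0.
- move=> c hc j; have [phi [phi0 phiE]] := h j.
  have := phi0 _ hc; rewrite linear_sum (bigD1 j) //= linearZ /= phiE eqxx.
  rewrite big1 => [|i ij]; last by rewrite linearZ /= phiE (negPf ij) [_ *: _]mulr0.
  by rewrite addr0 [_ *: _]mulr1.
Qed.

End HeisenbergMultiplier.

(** A presentation of L is, after an isomorphism L -> M, a presentation of M
    with the same kernel. *)
Lemma dim_multiplier_isom (K : fieldType) (L M : lieSuperType K) d :
  lie_isom L M -> (forall P : free_presentation M, dim_multiplier P d) ->
  forall P : free_presentation L, dim_multiplier P d.
Proof.
move=> [f [fg fb] [g fK gK]] dM P; have [pg pb] := fp_hom P.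
pose q : {linear fp_free P -> M} := f \o fp_map P.
have qhom : lie_hom q.
  by split=> [b x /pg/fg|x y] //; rewrite /= pb fb.
have qsurj y : exists x, q x = y.
  by have [x px] := fp_surj P (g y); exists x; rewrite /= px gK.
pose P' := FreePresentation (fp_freeP P) qhom qsurj.
suff kE : fp_ker P' = fp_ker P by have := dM P'; rewrite /dim_multiplier kE.
apply/seteqP; split=> x /=; rewrite /fp_ker /= => h.
  by apply: (can_inj fK); rewrite h linear0.
by rewrite h linear0.
Qed.

Lemma heis_superdim (K : fieldType) (L : lieSuperType K) m n :
  superdim L m n -> lie_isom L (heisenberg K) -> m = 3 /\ n = 0.
Proof.
move=> /superdim_hbasis[B] [f [fg fb] [g fK gK]].
have n0 : n = 0.
  case: n B => // n B.
  have g1 : grade true (bas B (rshift m ord0)).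
    by have := bas_grade B (rshift m ord0); rewrite leq_addr.
  have f0 : f (bas B (rshift m ord0)) = 0 := fg _ _ g1.
  have := coords_bas B (rshift m ord0).
  have -> : bas B (rshift m ord0) = 0.
    by apply: (can_inj fK); rewrite linear0.
  rewrite linear0 => /rowP/(_ (rshift m ord0))/esym/eqP.
  by rewrite !mxE !eqxx oner_eq0.
split=> //.
pose A := \matrix_i (f (bas B i) : 'rV_3).
have mulA (u : 'rV_(m + n)) : u *m A = f (\sum_i u 0 i *: bas B i).
  rewrite mulmx_sum_row linear_sum; apply: eq_bigr => i _.
  by rewrite rowK linearZ.
have rA : \rank A = (m + n)%N.
  apply/eqP/inj_row_free => u; rewrite mulA => fu.
  have u0 : \sum_i u 0 i *: bas B i = 0 by apply: (can_inj fK); rewrite linear0.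
  rewrite [LHS]row_sum_delta -[RHS](linear0 (coords B)) -u0 linear_sum.
  by apply: eq_bigr => i _; rewrite linearZ /= coords_bas.
have rA3 : \rank A = 3.
  apply/eqP; rewrite -[_ == _]/(row_full A) -sub1mx; apply/row_subP => i.
  set r := row i _; rewrite -[r](gK r) (coordsK B (g r)) -mulA; exact: submxMl.
by move: rA; rewrite rA3 n0 addn0.
Qed.

Theorem corollary3p12 (K : closedFieldType)
    (char2 : 2%N \notin [pchar K]) (char3 : 3%N \notin [pchar K])
    (L : lieSuperType K) (m n : nat)
    (dimL : superdim L m n) (nilL : nilpotent L)
    (P : free_presentation L) :
  (exists d : nat, dim_multiplier P d /\
     d%:R = 2^-1 * ((m%:R + n%:R) ^+ 2 + (n%:R - m%:R)) - 1 :> rat)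
  <-> lie_isom L (heisenberg K).
Proof.
split=> [[d [dM dE]]|iso]; last first.
  exists 2; have [-> ->] := heis_superdim dimL iso; split=> //.
  exact: (dim_multiplier_isom iso (heis_multiplier char2)).
have [B] := superdim_hbasis dimL.
have Dd : #|wpairs (fun i : 'I_(m + n) => (m <= i)%N)| = d.+1.
  have := card_wpairs m n; set D := #|_| => cD.
  have {}cD : (2 * D%:R + m%:R = (m%:R + n%:R) ^+ 2 + n%:R :> rat).
    by rewrite -!natrM -!natrD -natrX -natrD cD.
  apply/eqP; rewrite -(Num.Theory.eqr_nat rat) -addn1 natrD; apply/eqP.
  lra.
have [[x [y xy]]|ab] := pselect (exists x y : L, brk x y <> 0); last first.
  have abL x y : brk x y = 0 :> L.
    by apply/eqP/negPn/negP => /eqP xy; apply: ab; exists x, y.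
  by have := abelian_multiplier_ge char2 B abL dM; rewrite Dd ltnn.
have [w [wbrk wspan]] := wedge_span B P char2.
have [winj [b [z [z0 gz [i [j zij]] line]]]] :=
  multiplier_corank1 wbrk wspan dM Dd (ex_intro _ x (ex_intro _ y xy)).
have zc := nilpotent_line_central nilL gz line.
exact: (heisenberg_char char2 char3 (wedge_jacobi wspan winj) gz z0 line
  (fun x => proj1 (zc x)) (fun x => proj2 (zc x))
  (bas_grade B i) (bas_grade B j) zij).
Qed.
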